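(* Let $k$ be a field, let $\mathcal{C}$ be a small $k$-linear category and let $M$ be a right $\mathcal{C}$-module. There is a cohomological long exact sequence $$0\to HH^0(\mathcal{C}[M])\to HH^0(\mathcal{C})\to \mathrm{Hom}_{\mathcal{C}}(M,M)/k\to HH^1(\mathcal{C}[M])\to HH^1(\mathcal{C})\to\mathrm{Ext}^1_{\mathcal{C}}(M,M)\to\cdots$$ $$\cdots\to\mathrm{Ext}^{n-1}_{\mathcal{C}}(M,M)\to HH^n(\mathcal{C}[M])\to HH^n(\mathcal{C})\to\mathrm{Ext}^n_{\mathcal{C}}(M,M)\to HH^{n+1}(\mathcal{C}[M])\to\cdots$$
   Context: A small category $\mathcal{C}$ with object set $\mathcal{C}_0$ is $k$-linear if each set ${}_y\mathcal{C}_x$ of morphisms from $x$ to $y$ is a $k$-vector space and composition ${}_z\mathcal{C}_y\otimes_k{}_y\mathcal{C}_x\to{}_z\mathcal{C}_x$ is $k$-bilinear. A right $\mathcal{C}$-module is a contravariant $k$-linear functor from $\mathcal{C}$ to $k$-vector spaces, i.e. a family $(M_x)_{x\in\mathcal{C}_0}$ with associative unital actions $M_x\otimes_k{}_x\mathcal{C}_y\to M_y$; $\mathrm{Hom}_{\mathcal{C}}$ and $\mathrm{Ext}_{\mathcal{C}}$ are taken in the category of right $\mathcal{C}$-modules. $\mathrm{Hom}_{\mathcal{C}}(M,M)/k$ denotes the quotient of $\mathrm{Hom}_{\mathcal{C}}(M,M)$ by the scalar multiples of the identity, i.e. by the image of $k\to\mathrm{Hom}_{\mathcal{C}}(M,M)$,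 $\lambda\mapsto\lambda\,\mathrm{id}_M$. One-point extension: $\mathcal{C}[M]$ is the $k$-linear category with object set $\mathcal{C}_0\sqcup\{M\}$ and morphisms, for $x,y\in\mathcal{C}_0$, ${}_y\mathcal{C}[M]_x={}_y\mathcal{C}_x$, ${}_M\mathcal{C}[M]_x=M_x$, ${}_y\mathcal{C}[M]_M=0$, ${}_M\mathcal{C}[M]_M=k$; composition is given by the composition of $\mathcal{C}$, the action of $\mathcal{C}$ on $M$, and the $k$-vector space structure of each $M_x$. Hochschild-Mitchell cohomology of a small $k$-linear category $\mathcal{A}$: $HH^n(\mathcal{A})$ is the cohomology of the complex $$C^n(\mathcal{A},\mathcal{A})=\prod_{(x_1,\dots,x_{n+1})\in\mathcal{A}_0^{n+1}}\mathrm{Hom}_k({}_{x_{n+1}}\mathcal{A}_{x_n}\otimes_k\dots\otimes_k{}_{x_2}\mathcal{A}_{x_1},\ {}_{x_{n+1}}\mathcal{A}_{x_1}),\qquad C^0(\mathcal{A},\mathcal{A})=\prod_x{}_x\mathcal{A}_x,$$ with differential $(d\varphi)(f_1\otimes\dots\otimes f_{n+1})=f_1\varphi(f_2\otimes\dots\otimes f_{n+1})+\sum_{i=1}^{n}(-1)^i\varphi(f_1\otimes\dots\otimes f_if_{i+1}\otimes\dots\otimes f_{n+1})+(-1)^{n+1}\varphi(f_1\otimes\dots\otimes f_n)f_{n+1}$. Equivalently, $HH^n(\mathcal{A})=\mathrm{Ext}^n(\mathcal{A},\mathcal{A})$ in the category of $\mathcal{A}$-bimodules.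
   Formalization: Injectivity of HH^0(C[M]) → HH^0(C) (the initial ''0 →'') is claimed only for M ≠ 0; it fails for M = 0, e.g. for C empty, where HH^0(C[M]) = k and HH^0(C) = 0. All other exactness claims are kept for every M. *)

(* Defs.v *)
From HB Require Import structures.
From mathcomp Require Import all_boot all_algebra ring_quotient.
From mathcomp Require Import boolp.

Set Implicit Arguments.
Unset Strict Implicit.
Unset Printing Implicit Defensive.
Import GRing.Theory.
Local Open Scope ring_scope.
Local Open Scope quotient_scope.

Section LinearFun.
Variables (k : fieldType) (U V : lmodType k) (f : U -> V).
Hypothesis f_lin : linear f.

Lemma linear_zero : f 0 = 0.
Proof.
by have := f_lin (-1) 0 0; rewrite scaler0 addr0 scaleN1r addNr.
Qed.

Lemma linear_scale a u : f (a *: u) = a *: f u.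
Proof. by have := f_lin a u 0; rewrite linear_zero !addr0. Qed.

Lemma linear_add u v : f (u + v) = f u + f v.
Proof. by have := f_lin 1 u v; rewrite !scale1r. Qed.

End LinearFun.

Section Kernel.
Variables (k : fieldType) (U V : lmodType k) (f : {linear U -> V}).

Definition kerp : {pred U} := fun u => f u == 0.

Fact kerp_closed : submod_closed kerp.
Proof.
split=> [|a u v]; first by rewrite unfold_in linear0.
by rewrite !unfold_in linearP => /eqP-> /eqP->; rewrite scaler0 addr0.
Qed.
HB.instance Definition _ := GRing.isSubmodClosed.Build k U kerp kerp_closed.

Record kernel := Kernel { kerval : U; kervalP : kerval \in kerp }.
HB.instance Definition _ := [isSub for kerval].
HB.instance Definition _ := [Choice of kernel by <:].
HB.instance Definition _ := [SubChoice_isSubLmodule of kernel by <:].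

End Kernel.

Record subspace (k : fieldType) (V : lmodType k) := Subspace {
  subspace_mem : {pred V};
  subspace_closed : submod_closed subspace_mem
}.

Section Quotient.
Variables (k : fieldType) (V : lmodType k) (S : subspace V).

Let memS : {pred V} := subspace_mem S.
HB.instance Definition _ :=
  GRing.isSubmodClosed.Build k V memS (subspace_closed S).

Definition lquot := Quotient.quot memS.
HB.instance Definition _ := GRing.Zmodule.on lquot.

Definition lquot_pi (v : V) : lquot := \pi_lquot v.
Definition lquot_scale (a : k) (q : lquot) : lquot := lquot_pi (a *: repr q).

Lemma lquot_pi_eq u v : (lquot_pi u == lquot_pi v) = (u - v \in memS).
Proof. by rewrite Quotient.idealrBE. Qed.

Lemma lquot_scaleE a v : lquot_scale a (lquot_pi v) = lquot_pi (a *: v).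
Proof.
apply/eqP; rewrite lquot_pi_eq -scalerBr rpredZ //.
by rewrite -lquot_pi_eq /lquot_pi reprK.
Qed.

Lemma lquot_piP (q : lquot) : exists v, q = lquot_pi v.
Proof. by exists (repr q); rewrite /lquot_pi reprK. Qed.

Lemma lquot_piD u v : lquot_pi (u + v) = lquot_pi u + lquot_pi v.
Proof. by rewrite /lquot_pi piE. Qed.

Fact lquot_scaleA a b q :
  lquot_scale a (lquot_scale b q) = lquot_scale (a * b) q.
Proof. by have [v ->] := lquot_piP q; rewrite !lquot_scaleE scalerA. Qed.

Fact lquot_scale1 : left_id 1 lquot_scale.
Proof.
by move=> q; have [v ->] := lquot_piP q; rewrite lquot_scaleE scale1r.
Qed.

Fact lquot_scaleDr : right_distributive lquot_scale +%R.
Proof.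
move=> a q r; have [v ->] := lquot_piP q; have [w ->] := lquot_piP r.
by rewrite -lquot_piD !lquot_scaleE scalerDr lquot_piD.
Qed.

Fact lquot_scaleDl q : {morph lquot_scale^~ q : a b / a + b}.
Proof.
move=> a b; have [v ->] := lquot_piP q.
by rewrite !lquot_scaleE scalerDl lquot_piD.
Qed.

HB.instance Definition _ := GRing.Zmodule_isLmodule.Build k lquot
  lquot_scaleA lquot_scale1 lquot_scaleDr lquot_scaleDl.

Fact lquot_pi_linear : linear lquot_pi.
Proof. by move=> a u v; rewrite lquot_piD -lquot_scaleE. Qed.
HB.instance Definition _ :=
  GRing.isLinear.Build k V lquot _ lquot_pi lquot_pi_linear.

End Quotient.

Definition exact_at (k : fieldType) (U V W : lmodType k)
    (f : {linear U -> V}) (g : {linear V -> W}) : Prop :=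
  forall v, g v = 0 <-> exists u, f u = v.

Record complex (k : fieldType) := Complex {
  cpx :> nat -> lmodType k;
  cpx_d : forall n, {linear cpx n -> cpx n.+1};
  cpx_dd : forall n (u : cpx n), cpx_d n.+1 (cpx_d n u) = 0
}.

Section Cohomology.
Variables (k : fieldType) (X : complex k).

Definition cocycle n : lmodType k := kernel (cpx_d X n).

Definition is_coboundary n : X n -> Prop :=
  match n with
  | 0 => fun u => u = 0
  | m.+1 => fun u => exists v, cpx_d X m v = u
  end.

Definition coboundary n : {pred cocycle n} :=
  fun u => `[< is_coboundary (kerval u) >].

Fact coboundary_closed n : submod_closed (@coboundary n).
Proof.
case: n => [|n]; split; rewrite /coboundary.
- exact/asboolP.
- move=> a u v /asboolP /= u0 /asboolP /= v0; apply/asboolP => /=.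
  by rewrite u0 v0 scaler0 addr0.
- by apply/asboolP; exists 0; rewrite linear0.
- move=> a u v /asboolP [x dx] /asboolP [y dy]; apply/asboolP.
  by exists (a *: x + y); rewrite linearP dx dy.
Qed.

Definition cohomology n : lmodType k := lquot (Subspace (@coboundary_closed n)).

End Cohomology.

(** [hom x y] is the space of morphisms from [x] to [y]. *)
Record lincat (k : fieldType) := LinCat {
  obj :> Type;
  hom : obj -> obj -> lmodType k;
  idm : forall x, hom x x;
  comp : forall x y z, hom y z -> hom x y -> hom x z;
  comp_linl : forall x y z (f : hom x y), linear (fun g : hom y z => comp g f);
  comp_linr : forall x y z (g : hom y z), linear (fun f : hom x y => comp g f);
  compA : forall w x y z (h : hom y z) (g : hom x y) (f : hom w x),
    comp h (comp g f) = comp (comp h g) f;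
  comp1m : forall x y (f : hom x y), comp (idm y) f = f;
  compm1 : forall x y (f : hom x y), comp f (idm x) = f
}.

Arguments hom {k} l x y.
Arguments idm {k} l x.
Arguments comp {k l x y z} g f.

Record rmod (k : fieldType) (C : lincat k) := RMod {
  rsp :> C -> lmodType k;
  act : forall x y, rsp x -> hom C y x -> rsp y;
  act_linl : forall x y (f : hom C y x), linear (fun m : rsp x => act m f);
  act_linr : forall x y (m : rsp x), linear (fun f : hom C y x => act m f);
  actA : forall x y z (m : rsp x) (f : hom C y x) (g : hom C z y),
    act (act m f) g = act m (comp f g);
  act1 : forall x (m : rsp x), act m (idm C x) = m
}.

Arguments act {k C r x y} m f.

Section ModHom.
Variables (k : fieldType) (C : lincat k) (M N : rmod C).

Record modhom := ModHom {
  mfun :> forall x, M x -> N x;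
  mfun_lin : forall x, linear (@mfun x);
  mfun_act : forall x y (m : M x) (f : hom C y x),
    mfun (act m f) = act (mfun m) f
}.

Lemma modhom_eq (f g : modhom) : (forall x (m : M x), f x m = g x m) -> f = g.
Proof.
case: f g => [f lf nf] [g lg ng] /= fg.
have e : f = g by apply: functional_extensionality_dep => x; apply/funext.
by subst g; congr ModHom; apply: Prop_irrelevance.
Qed.

HB.instance Definition _ := gen_eqMixin modhom.
HB.instance Definition _ := gen_choiceMixin modhom.

Fact modhom0_lin x : linear (fun _ : M x => 0 : N x).
Proof. by move=> a m n; rewrite scaler0 addr0. Qed.
Fact modhom0_act x y (m : M x) (f : hom C y x) : 0 = act (0 : N x) f.
Proof. by rewrite (linear_zero (act_linl f)). Qed.
Definition modhom0 := ModHom modhom0_lin modhom0_act.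

Fact modhomD_lin (f g : modhom) x : linear (fun m : M x => f x m + g x m).
Proof. by move=> a m n; rewrite !mfun_lin scalerDr addrACA. Qed.
Fact modhomD_act (f g : modhom) x y (m : M x) (h : hom C y x) :
  f y (act m h) + g y (act m h) = act (f x m + g x m) h.
Proof. by rewrite !mfun_act (linear_add (act_linl h)). Qed.
Definition modhomD f g := ModHom (modhomD_lin f g) (modhomD_act f g).

Fact modhomZ_lin a (f : modhom) x : linear (fun m : M x => a *: f x m).
Proof. by move=> b m n; rewrite !mfun_lin scalerDr !scalerA mulrC. Qed.
Fact modhomZ_act a (f : modhom) x y (m : M x) (h : hom C y x) :
  a *: f y (act m h) = act (a *: f x m) h.
Proof. by rewrite mfun_act (linear_scale (act_linl h)). Qed.
Definition modhomZ a f := ModHom (modhomZ_lin a f) (modhomZ_act a f).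

Fact modhomDA : associative modhomD.
Proof. by move=> f g h; apply: modhom_eq => x m /=; rewrite addrA. Qed.
Fact modhomDC : commutative modhomD.
Proof. by move=> f g; apply: modhom_eq => x m /=; rewrite addrC. Qed.
Fact modhom0D : left_id modhom0 modhomD.
Proof. by move=> f; apply: modhom_eq => x m /=; rewrite add0r. Qed.
Fact modhomND : left_inverse modhom0 (modhomZ (-1)) modhomD.
Proof. by move=> f; apply: modhom_eq => x m /=; rewrite scaleN1r addNr. Qed.
HB.instance Definition _ :=
  GRing.isZmodule.Build modhom modhomDA modhomDC modhom0D modhomND.

Fact modhomZA a b f : modhomZ a (modhomZ b f) = modhomZ (a * b) f.
Proof. by apply: modhom_eq => x m /=; rewrite scalerA. Qed.
Fact modhom1Z : left_id 1 modhomZ.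
Proof. by move=> f; apply: modhom_eq => x m /=; rewrite scale1r. Qed.
Fact modhomZDr : right_distributive modhomZ +%R.
Proof. by move=> a f g; apply: modhom_eq => x m /=; rewrite scalerDr. Qed.
Fact modhomZDl f : {morph modhomZ^~ f : a b / a + b}.
Proof. by move=> a b; apply: modhom_eq => x m /=; rewrite scalerDl. Qed.
HB.instance Definition _ :=
  GRing.Zmodule_isLmodule.Build k modhom modhomZA modhom1Z modhomZDr modhomZDl.

End ModHom.

Section ModComp.
Variables (k : fieldType) (C : lincat k).

Definition modid (M : rmod C) : modhom M M.
Proof. by exists (fun x m => m). Defined.

Definition modcomp (L M N : rmod C) (g : modhom M N) (f : modhom L M) :
  modhom L N.
Proof.
exists (fun x m => g x (f x m)) => [x a m n | x y m h].
  by rewrite !mfun_lin.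
by rewrite !mfun_act.
Defined.

End ModComp.

Section ScalarEnd.
Variables (k : fieldType) (C : lincat k) (M : rmod C).

Definition scalar_end : {pred modhom M M} :=
  fun f => `[< exists a : k, f = a *: modid M >].

Fact scalar_end_closed : submod_closed scalar_end.
Proof.
split; first by apply/asboolP; exists 0; rewrite scale0r.
move=> c f g /asboolP [a ->] /asboolP [b ->]; apply/asboolP.
by exists (c * a + b); rewrite scalerDl scalerA.
Qed.

Definition end_mod_scalars : lmodType k := lquot (Subspace scalar_end_closed).

End ScalarEnd.

Definition projective (k : fieldType) (C : lincat k) (P : rmod C) : Prop :=
  forall (A B : rmod C) (e : modhom A B) (g : modhom P B),
    (forall x (b : B x), exists a, e x a = b) ->
    exists f : modhom P A, modcomp e f = g.

Record proj_resolution (k : fieldType) (C : lincat k) (M : rmod C) :=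
  ProjResolution {
  pres :> nat -> rmod C;
  pres_d : forall n, modhom (pres n.+1) (pres n);
  pres_aug : modhom (pres 0) M;
  pres_projective : forall n, projective (pres n);
  pres_aug_surj : forall x (m : M x), exists p, pres_aug x p = m;
  pres_exact0 : forall x (p : pres 0 x),
    pres_aug x p = 0 <-> exists q, pres_d 0 x q = p;
  pres_exact : forall n x (p : pres n.+1 x),
    pres_d n x p = 0 <-> exists q, pres_d n.+1 x q = p
}.

Section Ext.
Variables (k : fieldType) (C : lincat k) (M : rmod C).
Variables (P : proj_resolution M) (N : rmod C).

Definition precomp n (f : modhom (P n) N) : modhom (P n.+1) N :=
  modcomp f (pres_d P n).

Fact precomp_linear n : linear (@precomp n).
Proof. by move=> a f g; apply: modhom_eq. Qed.
HB.instance Definition _ n := GRing.isLinear.Build k _ _ _ _ (@precomp_linear n).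

Fact precomp_dd n (f : modhom (P n) N) : precomp (precomp f) = 0.
Proof.
apply: modhom_eq => x p /=.
have -> : pres_d P n x (pres_d P n.+1 x p) = 0.
  by apply/pres_exact; exists p.
exact: (linear_zero (@mfun_lin _ _ _ _ f x)).
Qed.

Definition hom_complex : complex k :=
  @Complex k (fun n => modhom (P n) N) (fun n => @precomp n) precomp_dd.

(** Ext^n_C(M, N), which does not depend on the projective resolution [P] of [M]
    up to isomorphism; [free_resolution] below shows that one exists. *)
Definition Ext n : lmodType k := cohomology hom_complex n.

End Ext.

Section FreeModule.
Variables (k : fieldType) (C : lincat k) (N : rmod C).

(** The free right module on the family of sets [N]: formal combinations of
    generators [m f], identified when they take the same value under every
    assignment of the generators in a right module. *)
Inductive fterm (x : C) : Type :=
  | FZero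
  | FGen (y : C) (m : N y) (f : hom C x y)
  | FAdd (s t : fterm x)
  | FScale (a : k) (t : fterm x).

Arguments FZero {x}.
Arguments FGen {x y} m f.

Section Eval.
Variables (A : rmod C) (h : forall y, N y -> A y).

Fixpoint feval x (t : fterm x) : A x :=
  match t with
  | FZero => 0
  | FGen y m f => act (h m) f
  | FAdd s t => feval s + feval t
  | FScale a t => a *: feval t
  end.

End Eval.

Section Carrier.
Variable x : C.

HB.instance Definition _ := gen_eqMixin (fterm x).
HB.instance Definition _ := gen_choiceMixin (fterm x).

Definition feqv : rel (fterm x) :=
  fun s t => `[< forall (A : rmod C) (h : forall y, N y -> A y), feval h s = feval h t >].

Fact feqv_refl : reflexive feqv. Proof. by move=> s; apply/asboolP. Qed.
Fact feqv_sym : symmetric feqv.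
Proof. by move=> s t; apply/asboolP/asboolP => st A h; rewrite st. Qed.
Fact feqv_trans : transitive feqv.
Proof.
by move=> t s u /asboolP st /asboolP tu; apply/asboolP => A h; rewrite st tu.
Qed.

Canonical feqv_equiv := EquivRel feqv feqv_refl feqv_sym feqv_trans.

Definition free := {eq_quot feqv}.
HB.instance Definition _ := Choice.on free.

Definition fpi (t : fterm x) : free := \pi_free t.
Definition fev (A : rmod C) (h : forall y, N y -> A y) (q : free) : A x :=
  feval h (repr q).

Lemma fev_pi (A : rmod C) (h : forall y, N y -> A y) t : fev h (fpi t) = feval h t.
Proof.
have /eqmodP/asboolP e : repr (fpi t) = t %[mod free] by rewrite reprK.
exact: e.
Qed.

Lemma free_ind (P : free -> Prop) : (forall t, P (fpi t)) -> forall q, P q.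
Proof. by move=> Pt q; rewrite -[q]reprK; apply: Pt. Qed.

Lemma free_eq (q r : free) :
  (forall (A : rmod C) (h : forall y, N y -> A y), fev h q = fev h r) -> q = r.
Proof.
elim/free_ind: q => s; elim/free_ind: r => t e.
by apply/eqmodP/asboolP => A h; rewrite -!fev_pi.
Qed.

Definition free0 : free := fpi FZero.
Definition freeD (q r : free) : free := fpi (FAdd (repr q) (repr r)).
Definition freeZ a (q : free) : free := fpi (FScale a (repr q)).

Lemma fev0 (A : rmod C) (h : forall y, N y -> A y) : fev h free0 = 0.
Proof. by rewrite fev_pi. Qed.
Lemma fevD (A : rmod C) (h : forall y, N y -> A y) q r :
  fev h (freeD q r) = fev h q + fev h r.
Proof. by rewrite fev_pi. Qed.
Lemma fevZ (A : rmod C) (h : forall y, N y -> A y) a q : fev h (freeZ a q) = a *: fev h q.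
Proof. by rewrite fev_pi. Qed.

Fact freeDA : associative freeD.
Proof. by move=> p q r; apply: free_eq => A h; rewrite !fevD addrA. Qed.
Fact freeDC : commutative freeD.
Proof. by move=> p q; apply: free_eq => A h; rewrite !fevD addrC. Qed.
Fact free0D : left_id free0 freeD.
Proof. by move=> p; apply: free_eq => A h; rewrite fevD fev0 add0r. Qed.
Fact freeND : left_inverse free0 (freeZ (-1)) freeD.
Proof.
by move=> p; apply: free_eq => A h; rewrite fevD fevZ fev0 scaleN1r addNr.
Qed.
HB.instance Definition _ :=
  GRing.isZmodule.Build free freeDA freeDC free0D freeND.

Fact freeZA a b q : freeZ a (freeZ b q) = freeZ (a * b) q.
Proof. by apply: free_eq => A h; rewrite !fevZ scalerA. Qed.
Fact free1Z : left_id 1 freeZ.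
Proof. by move=> q; apply: free_eq => A h; rewrite fevZ scale1r. Qed.
Fact freeZDr : right_distributive freeZ +%R.
Proof.
by move=> a q r; apply: free_eq => A h; rewrite !(fevD, fevZ) scalerDr.
Qed.
Fact freeZDl q : {morph freeZ^~ q : a b / a + b}.
Proof.
by move=> a b; apply: free_eq => A h; rewrite !(fevD, fevZ) scalerDl.
Qed.
HB.instance Definition _ :=
  GRing.Zmodule_isLmodule.Build k free freeZA free1Z freeZDr freeZDl.

Fact fev_linear (A : rmod C) (h : forall y, N y -> A y) : linear (fev h).
Proof. by move=> a q r; rewrite fevD fevZ. Qed.

End Carrier.

Fixpoint ftact x y (t : fterm x) (f : hom C y x) : fterm y :=
  match t with
  | FZero => FZero
  | FGen z m g => FGen m (comp g f)
  | FAdd s t => FAdd (ftact s f) (ftact t f)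
  | FScale a t => FScale a (ftact t f)
  end.

Lemma feval_act (A : rmod C) (h : forall y, N y -> A y) x y (t : fterm x)
    (f : hom C y x) : feval h (ftact t f) = act (feval h t) f.
Proof.
elim: t => [|z m g|s IHs t IHt|a t IH] /=.
- by rewrite (linear_zero (act_linl f)).
- by rewrite actA.
- by rewrite IHs IHt (linear_add (act_linl f)).
- by rewrite IH (linear_scale (act_linl f)).
Qed.

Definition free_act x y (q : free x) (f : hom C y x) : free y :=
  fpi (ftact (repr q) f).

Lemma fev_act (A : rmod C) (h : forall y, N y -> A y) x y (q : free x) (f : hom C y x) :
  fev h (free_act q f) = act (fev h q) f.
Proof. by rewrite fev_pi feval_act. Qed.

Fact free_act_linl x y (f : hom C y x) : linear (fun q : free x => free_act q f).
Proof.
move=> a q r; apply: free_eq => A h.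
by rewrite fev_act !fev_linear !fev_act act_linl.
Qed.

Fact free_act_linr x y (q : free x) : linear (fun f : hom C y x => free_act q f).
Proof.
move=> a f g; apply: free_eq => A h.
by rewrite fev_act fev_linear !fev_act act_linr.
Qed.

Fact free_actA x y z (q : free x) (f : hom C y x) (g : hom C z y) :
  free_act (free_act q f) g = free_act q (comp f g).
Proof. by apply: free_eq => A h; rewrite !fev_act actA. Qed.

Fact free_act1 x (q : free x) : free_act q (idm C x) = q.
Proof. by apply: free_eq => A h; rewrite fev_act act1. Qed.

Definition free_mod : rmod C := RMod free_act_linl free_act_linr free_actA free_act1.

Definition free_map (A : rmod C) (h : forall y, N y -> A y) : modhom free_mod A :=
  @ModHom _ _ free_mod A (fun x => @fev x A h) (fun x => @fev_linear x A h)
    (@fev_act A h).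

Definition free_gen y (m : N y) : free_mod y := fpi (FGen m (idm C y)).

Definition free_aug : modhom free_mod N := free_map (fun y m => m).

Lemma free_aug_surj x (m : N x) : exists q, free_aug x q = m.
Proof. by exists (free_gen m); rewrite /= fev_pi /= act1. Qed.

Lemma free_projective : projective free_mod.
Proof.
move=> A B e g e_surj.
pose h y (m : N y) : A y := projT1 (cid (e_surj y (g y (free_gen m)))).
have hE y m : e y (h y m) = g y (free_gen m).
  by rewrite /h; case: cid.
exists (free_map h); apply: modhom_eq => x; elim/free_ind => t /=.
rewrite fev_pi; elim: t => [|y m f|s IHs t IHt|a t IH] /=.
- rewrite (linear_zero (@mfun_lin _ _ _ _ e x)).
  exact: (esym (linear_zero (@mfun_lin _ _ _ _ g x))).
- rewrite mfun_act hE -mfun_act; congr (g x _); apply: free_eq => D l.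
  by rewrite fev_act !fev_pi /= act1.
- rewrite (linear_add (@mfun_lin _ _ _ _ e x)) IHs IHt.
  rewrite -(linear_add (@mfun_lin _ _ _ _ g x)); congr (g x _).
  by apply: free_eq => D l; rewrite fevD !fev_pi.
- rewrite (linear_scale (@mfun_lin _ _ _ _ e x)) IH.
  rewrite -(linear_scale (@mfun_lin _ _ _ _ g x)); congr (g x _).
  by apply: free_eq => D l; rewrite fevZ !fev_pi.
Qed.

End FreeModule.

Section KernelModule.
Variables (k : fieldType) (C : lincat k) (L N : rmod C) (f : modhom L N).

HB.instance Definition _ x :=
  GRing.isLinear.Build k (L x) (N x) _ (f x) (@mfun_lin _ _ _ _ f x).

Definition ker_sp (x : C) : lmodType k := kernel (f x).

Fact ker_act_subproof x y (m : ker_sp x) (g : hom C y x) :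
  act (kerval m) g \in kerp (f y).
Proof.
have fm : f x (kerval m) = 0 by exact/eqP/(kervalP m).
apply/eqP/(etrans (mfun_act f (kerval m) g)).
by rewrite fm (linear_zero (act_linl g)).
Qed.

Definition ker_act x y (m : ker_sp x) (g : hom C y x) : ker_sp y :=
  Kernel (ker_act_subproof m g).

Fact ker_act_linl x y (g : hom C y x) : linear (fun m : ker_sp x => ker_act m g).
Proof. by move=> a m n; apply: val_inj; rewrite /= act_linl. Qed.
Fact ker_act_linr x y (m : ker_sp x) : linear (fun g : hom C y x => ker_act m g).
Proof. by move=> a g h; apply: val_inj; rewrite /= act_linr. Qed.
Fact ker_actA x y z (m : ker_sp x) (g : hom C y x) (h : hom C z y) :
  ker_act (ker_act m g) h = ker_act m (comp g h).
Proof. by apply: val_inj; rewrite /= actA. Qed.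
Fact ker_act1 x (m : ker_sp x) : ker_act m (idm C x) = m.
Proof. by apply: val_inj; rewrite /= act1. Qed.

Definition ker_mod : rmod C :=
  RMod ker_act_linl ker_act_linr ker_actA ker_act1.

Definition ker_incl : modhom ker_mod L.
Proof. by exists (fun x (m : ker_sp x) => kerval m). Defined.

Lemma ker_inclP x (m : L x) : f x m = 0 <-> exists q, ker_incl x q = m.
Proof.
split=> [/eqP fm | [q <-]]; last exact/eqP/(kervalP q).
by exists (Kernel (fm : m \in kerp (f x))).
Qed.

Lemma ker_incl_eq0 x (q : ker_mod x) : ker_incl x q = 0 <-> q = 0.
Proof. by split=> [q0 | ->] //; apply: val_inj. Qed.

End KernelModule.

Section Existence.
Variables (k : fieldType) (C : lincat k) (M : rmod C).

Fixpoint syzygy n : rmod C :=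
  match n with
  | 0 => M
  | m.+1 => ker_mod (free_aug (syzygy m))
  end.

Definition syz_d n :
    modhom (free_mod (syzygy n.+1)) (free_mod (syzygy n)) :=
  modcomp (ker_incl (free_aug (syzygy n))) (free_aug (syzygy n.+1)).

Lemma syz_dP n x (p : free_mod (syzygy n) x) :
  free_aug (syzygy n) x p = 0 <-> exists q, syz_d n x q = p.
Proof.
rewrite ker_inclP; split=> [[q <-]|[q <-]]; last by eexists.
by have [r <-] := free_aug_surj q; exists r.
Qed.

Lemma syz_exact n x (p : free_mod (syzygy n.+1) x) :
  syz_d n x p = 0 <-> exists q, syz_d n.+1 x q = p.
Proof. by rewrite -syz_dP -ker_incl_eq0. Qed.

Definition free_resolution : proj_resolution M :=
  @ProjResolution k C M (fun n => free_mod (syzygy n)) syz_d (free_aug M)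
    (fun n => free_projective (N := syzygy n)) (@free_aug_surj _ _ M)
    (@syz_dP 0) syz_exact.

End Existence.

Section OnePoint.
Variables (k : fieldType) (C : lincat k) (M : rmod C).

(** [None] is the added object, and [M x] the space of morphisms from [x] to
    it. *)
Definition op_hom (x y : option C) : lmodType k :=
  match x, y with
  | Some x, Some y => hom C x y
  | Some x, None => M x
  | None, Some _ => 'rV[k]_0
  | None, None => k^o
  end.

Definition op_id (x : option C) : op_hom x x :=
  match x with
  | Some x => idm C x
  | None => (1 : k^o)
  end.

Definition op_comp (x y z : option C) :
    op_hom y z -> op_hom x y -> op_hom x z :=
  match x, y, z with
  | Some x, Some y, Some z => fun g f => comp g f
  | Some x, Some y, None => fun m f => act m f
  | Some x, None, None => fun (a : k) m => a *: m
  | None, None, None => fun a b : k => a * b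
  | _, _, _ => fun _ _ => 0
  end.

Fact op_comp_linl x y z (f : op_hom x y) :
  linear (fun g : op_hom y z => op_comp g f).
Proof.
case: x y z f => [x|] [y|] [z|] f a g h //=;
  rewrite ?scaler0 ?addr0 //.
- exact: comp_linl.
- exact: act_linl.
- by rewrite scalerDl scalerA.
- by rewrite mulrDl -mulrA.
Qed.

Fact op_comp_linr x y z (g : op_hom y z) :
  linear (fun f : op_hom x y => op_comp g f).
Proof.
case: x y z g => [x|] [y|] [z|] g a f h //=;
  rewrite ?scaler0 ?addr0 //.
- exact: comp_linr.
- exact: act_linr.
- by rewrite scalerDr !scalerA mulrC.
- by rewrite mulrDr mulrCA.
Qed.

Fact op_compA w x y z (h : op_hom y z) (g : op_hom x y) (f : op_hom w x) :
  op_comp h (op_comp g f) = op_comp (op_comp h g) f.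
Proof.
case: w x y z h g f => [w|] [x|] [y|] [z|] h g f //=;
  rewrite ?scale0r ?mulr0 ?mul0r //.
- exact: compA.
- by rewrite actA.
- by rewrite (linear_zero (comp_linl f)).
- by rewrite (linear_scale (act_linl f)).
- by rewrite (linear_zero (comp_linr h)).
- by rewrite (linear_zero (act_linr h)).
- by rewrite scalerA.
- by rewrite mulrA.
Qed.

Fact op_comp1m x y (f : op_hom x y) : op_comp (op_id y) f = f.
Proof.
case: x y f => [x|] [y|] f //=; rewrite ?comp1m ?scale1r ?mul1r //.
by rewrite [f]thinmx0.
Qed.

Fact op_compm1 x y (f : op_hom x y) : op_comp f (op_id x) = f.
Proof.
case: x y f => [x|] [y|] f //=; rewrite ?compm1 ?act1 ?mulr1 //.
by rewrite [f]thinmx0.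
Qed.

Definition one_point : lincat k :=
  LinCat op_comp_linl op_comp_linr op_compA op_comp1m op_compm1.

End OnePoint.

Section Hochschild.
Variables (k : fieldType) (C : lincat k).

(** [chain n x z] is the type of composable strings of [n] morphisms
    (f_1, ..., f_n) from [x] to [z], the outermost one f_1 first; letting the
    intermediate objects vary inside the string turns the product over tuples
    of objects into a dependent product over [chain n x z].  A string of length
    0 from [x] to [z] is a proof that [x = z]. *)
Fixpoint chain (n : nat) (x z : C) : Type :=
  match n with
  | 0 => x = z
  | m.+1 => {y : C & (hom C y z * chain m x y)%type}
  end.

Definition cons_chain n x y z (f : hom C y z) (c : chain n x y) :
  chain n.+1 x z := existT _ y (f, c).

(** Linearity in each entry of the string separately, i.e. a linear map on the
    tensor product, for each fixed tuple of objects. *)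
Fixpoint multilinear (n : nat) (x z : C) (V : lmodType k) :
    (chain n x z -> V) -> Prop :=
  match n with
  | 0 => fun _ => True
  | m.+1 => fun phi => forall y : C,
      (forall c : chain m x y,
         linear (fun f : hom C y z => phi (cons_chain f c))) /\
      (forall f : hom C y z, multilinear (fun c => phi (cons_chain f c)))
  end.

Definition merge_head n x z (c : chain n.+2 x z) : chain n.+1 x z :=
  let c' := (projT2 c).2 in
  cons_chain (comp (projT2 c).1 (projT2 c').1) (projT2 c').2.

(** Composes the entries in positions [i] and [i.+1], counted from 0. *)
Fixpoint merge (n i : nat) (x z : C) {struct n} :
    chain n.+2 x z -> chain n.+1 x z :=
  match n, i with
  | m.+1, j.+1 => fun c : chain m.+3 x z =>
      cons_chain (projT2 c).1 (merge j (projT2 c).2)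
  | m, _ => @merge_head m x z
  end.

Fixpoint split_last (n : nat) (x z : C) {struct n} :
    chain n.+1 x z -> {w : C & (chain n w z * hom C x w)%type} :=
  match n with
  | 0 => fun c : chain 1 x z =>
      existT _ z
        (erefl z, ecast w (hom C w z) (esym (projT2 c).2) (projT2 c).1)
  | m.+1 => fun c : chain m.+2 x z =>
      let s := split_last (projT2 c).2 in
      existT _ (projT1 s) (cons_chain (projT2 c).1 (projT2 s).1, (projT2 s).2)
  end.

Definition head_face n (phi : forall x z, chain n x z -> hom C x z)
    x z (c : chain n.+1 x z) : hom C x z :=
  comp (projT2 c).1 (phi _ _ (projT2 c).2).

Definition inner_faces n : (forall x z, chain n x z -> hom C x z) ->
    forall x z, chain n.+1 x z -> hom C x z :=
  match n with
  | 0 => fun _ _ _ _ => 0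
  | m.+1 => fun phi x z c =>
      \sum_(i < m.+1) (-1) ^+ i.+1 *: phi x z (merge i c)
  end.

Definition last_face n (phi : forall x z, chain n x z -> hom C x z)
    x z (c : chain n.+1 x z) : hom C x z :=
  comp (phi _ _ (projT2 (split_last c)).1) (projT2 (split_last c)).2.

(** d phi (f_1, ..., f_n.+1) =
      f_1 phi (f_2, ..., f_n.+1)
      + \sum_(1 <= i <= n) (-1)^i phi (f_1, ..., f_i f_i.+1, ..., f_n.+1)
      + (-1)^n.+1 phi (f_1, ..., f_n) f_n.+1 *)
Definition hoch_d_fun n (phi : forall x z, chain n x z -> hom C x z)
    x z (c : chain n.+1 x z) : hom C x z :=
  head_face phi c + inner_faces phi c + (-1) ^+ n.+1 *: last_face phi c.

Lemma ml_add n x z (V : lmodType k) (phi psi : chain n x z -> V) :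
  multilinear phi -> multilinear psi ->
  multilinear (fun c => phi c + psi c).
Proof.
elim: n z phi psi => [//|n IH] z phi psi /= hphi hpsi y.
have [h1 h2] := hphi y; have [h3 h4] := hpsi y; split=> [c a f g|f].
  by rewrite h1 h3 scalerDr addrACA.
exact: (IH y (fun c => phi (cons_chain f c)) (fun c => psi (cons_chain f c))).
Qed.

Lemma ml_scale n x z (V : lmodType k) a (phi : chain n x z -> V) :
  multilinear phi -> multilinear (fun c => a *: phi c).
Proof.
elim: n z phi => [//|n IH] z phi /= hphi y.
have [h1 h2] := hphi y; split=> [c b f g|f].
  by rewrite h1 scalerDr !scalerA mulrC.
exact: (IH y (fun c => phi (cons_chain f c))).
Qed.

Lemma ml_zero n x z (V : lmodType k) : multilinear (fun c : chain n x z => 0 : V).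
Proof.
elim: n z => [//|n IH] z y; split=> [c a f g|f]; last exact: IH.
by rewrite scaler0 addr0.
Qed.

Lemma ml_sum n x z (V : lmodType k) (I : Type) (r : seq I) (F : I -> chain n x z -> V) :
  (forall i, multilinear (F i)) -> multilinear (fun c => \sum_(i <- r) F i c).
Proof.
move=> hF; elim: r => [|i r IH].
  rewrite (_ : (fun _ => _) = fun=> 0) ?funeqE; first exact: ml_zero.
  by move=> c; rewrite big_nil.
rewrite (_ : (fun _ => _) = fun c => F i c + \sum_(j <- r) F j c).
  exact: ml_add.
by rewrite funeqE => c; rewrite big_cons.
Qed.

Lemma ml_comp n x z (V W : lmodType k) (h : V -> W) (phi : chain n x z -> V) :
  linear h -> multilinear phi -> multilinear (fun c => h (phi c)).
Proof.
move=> hl; elim: n z phi => [//|n IH] z phi /= hphi y.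
have [h1 h2] := hphi y; split=> [c a f g|f]; first by rewrite h1 hl.
exact: (IH y (fun c => phi (cons_chain f c))).
Qed.

Lemma ml_merge n i x z (V : lmodType k) (phi : chain n.+1 x z -> V) :
  multilinear phi -> multilinear (fun c : chain n.+2 x z => phi (merge i c)).
Proof.
have base m u (psi : chain m.+1 x u -> V) : multilinear psi ->
  multilinear (fun c : chain m.+2 x u => psi (merge_head c)).
  move=> hpsi y; split=> [[y' [g c]] a f f'|f]; rewrite /merge_head /=.
    by rewrite comp_linl; case: (hpsi y') => ->.
  move=> y'; split=> [c a g g'|g] /=.
    by rewrite comp_linr; case: (hpsi y') => ->.
  by case: (hpsi y') => _; apply.
elim: n i z phi => [|n IH] [|i] z phi hphi; try exact: base.
move=> y; have [h1 h2] := hphi y; split=> [c a f g|f] /=.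
  by rewrite h1.
exact: (IH i y (fun c => phi (cons_chain f c))).
Qed.

Lemma ml_last n x z t (phi : forall w, chain n w z -> hom C w t) :
  (forall w, multilinear (@phi w)) ->
  multilinear (fun c : chain n.+1 x z =>
    comp (phi _ (projT2 (split_last c)).1) (projT2 (split_last c)).2).
Proof.
elim: n z phi => [|n IH] z phi hphi y; split=> [c a f g|f] //=.
- by case: y / c f g => f g; rewrite /= comp_linr.
- by case: (hphi (projT1 (split_last c)) y) => -> _; rewrite comp_linl.
apply: (IH y (fun w c => phi w (cons_chain f c))) => w.
by case: (hphi w y) => _; apply.
Qed.

Record cochain (n : nat) := Cochain {
  cochain_fun :> forall x z, chain n x z -> hom C x z;
  cochain_ml : forall x z, multilinear (@cochain_fun x z)
}.

Lemma cochain_eq n (f g : cochain n) :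
  (forall x z (c : chain n x z), f x z c = g x z c) -> f = g.
Proof.
case: f g => [f hf] [g hg] /= fg.
have e : f = g.
  apply: functional_extensionality_dep => x.
  by apply: functional_extensionality_dep => z; apply/funext.
by subst g; congr Cochain; apply: Prop_irrelevance.
Qed.

HB.instance Definition _ n := gen_eqMixin (cochain n).
HB.instance Definition _ n := gen_choiceMixin (cochain n).

Section CochainSpace.
Variable n : nat.

Definition cochain0 : cochain n := Cochain (fun x z => @ml_zero n x z _).
Definition cochainD (f g : cochain n) : cochain n :=
  Cochain (fun x z => ml_add (@cochain_ml _ f x z) (@cochain_ml _ g x z)).
Definition cochainZ a (f : cochain n) : cochain n :=
  Cochain (fun x z => ml_scale a (@cochain_ml _ f x z)).

Fact cochainDA : associative cochainD.
Proof. by move=> f g h; apply: cochain_eq => x z c /=; rewrite addrA. Qed.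
Fact cochainDC : commutative cochainD.
Proof. by move=> f g; apply: cochain_eq => x z c /=; rewrite addrC. Qed.
Fact cochain0D : left_id cochain0 cochainD.
Proof. by move=> f; apply: cochain_eq => x z c /=; rewrite add0r. Qed.
Fact cochainND : left_inverse cochain0 (cochainZ (-1)) cochainD.
Proof.
by move=> f; apply: cochain_eq => x z c /=; rewrite scaleN1r addNr.
Qed.
HB.instance Definition _ :=
  GRing.isZmodule.Build (cochain n) cochainDA cochainDC cochain0D cochainND.

Fact cochainZA a b f : cochainZ a (cochainZ b f) = cochainZ (a * b) f.
Proof. by apply: cochain_eq => x z c /=; rewrite scalerA. Qed.
Fact cochain1Z : left_id 1 cochainZ.
Proof. by move=> f; apply: cochain_eq => x z c /=; rewrite scale1r. Qed.
Fact cochainZDr : right_distributive cochainZ +%R.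
Proof. by move=> a f g; apply: cochain_eq => x z c /=; rewrite scalerDr. Qed.
Fact cochainZDl f : {morph cochainZ^~ f : a b / a + b}.
Proof. by move=> a b; apply: cochain_eq => x z c /=; rewrite scalerDl. Qed.
HB.instance Definition _ := GRing.Zmodule_isLmodule.Build k (cochain n)
  cochainZA cochain1Z cochainZDr cochainZDl.

End CochainSpace.

Fact hoch_d_ml n (phi : cochain n) x z : multilinear (@hoch_d_fun n phi x z).
Proof.
apply: ml_add; first apply: ml_add.
- move=> y; split=> [c a f g|f]; first exact: comp_linl.
  exact: ml_comp (comp_linr f) (@cochain_ml _ phi x y).
- case: n phi => [|n] phi; first exact: ml_zero.
  by apply: ml_sum => i; apply/ml_scale/ml_merge/cochain_ml.
- apply: ml_scale; apply: (@ml_last n x z z (fun w => phi w z)) => w.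
  exact: cochain_ml.
Qed.

Definition hoch_d n (phi : cochain n) : cochain n.+1 :=
  Cochain (@hoch_d_ml n phi).

Fact hoch_d_linear n : linear (@hoch_d n).
Proof.
move=> a f g; apply: cochain_eq => x z c /=; rewrite /hoch_d_fun.
rewrite /head_face /last_face /= comp_linr comp_linl.
have -> : inner_faces (a *: f + g : cochain n) c =
          a *: inner_faces f c + inner_faces g c.
  case: n f g c => [|n] f g c /=; first by rewrite scaler0 addr0.
  rewrite scaler_sumr -big_split /=; apply: eq_bigr => i _.
  by rewrite scalerDr !scalerA mulrC.
rewrite !scalerDr !scalerA [_ * a]mulrC.
by rewrite (addrACA (a *: _) _ (a *: _)) (addrACA (_ + _)).
Qed.
HB.instance Definition _ n := GRing.isLinear.Build k _ _ _ _ (@hoch_d_linear n).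

(** The alternating sum of the faces other than the leading one, for functions
    with values in a fixed right module hom C - t. *)
Definition bar n z t (psi : forall w, chain n w z -> hom C w t)
    x (c : chain n.+1 x z) : hom C x t :=
  match n return (forall w, chain n w z -> hom C w t) ->
                 chain n.+1 x z -> hom C x t with
  | 0 => fun _ _ => 0
  | m.+1 => fun psi c => \sum_(i < m.+1) (-1) ^+ i *: psi x (merge i c)
  end psi c
  + (-1) ^+ n *:
    comp (psi _ (projT2 (split_last c)).1) (projT2 (split_last c)).2.

Lemma bar_eq n z t (psi psi' : forall w, chain n w z -> hom C w t) :
  (forall w c, psi w c = psi' w c) ->
  forall x (c : chain n.+1 x z), bar psi c = bar psi' c.
Proof.
move=> e x c; congr (bar _ c).
by apply: functional_extensionality_dep => w; apply/funext.
Qed.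

Lemma bar_nil z t y (psi : forall w, chain 0 w z -> hom C w t)
    (f : hom C y z) :
  bar psi (cons_chain f (erefl y : chain 0 y y)) = comp (psi z erefl) f.
Proof. by rewrite /bar /= add0r scale1r. Qed.

Lemma bar_cons n z t (psi : forall w, chain n.+1 w z -> hom C w t)
    x y w (f : hom C y z) (g : hom C w y) (c : chain n x w) :
  bar psi (cons_chain f (cons_chain g c)) =
  psi x (cons_chain (comp f g) c)
  - bar (fun w c => psi w (cons_chain f c)) (cons_chain g c).
Proof.
rewrite /bar opprD addrA; congr (_ + _); last first.
  by rewrite /= exprS mulN1r scaleNr.
case: n psi c => [|n] psi c; first by rewrite big_ord1 scale1r subr0.
rewrite big_ord_recl expr0 scale1r; congr (_ + _).
rewrite -sumrN; apply: eq_bigr => i _ /=.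
by rewrite exprS mulN1r scaleNr.
Qed.

Lemma hoch_dE n (phi : cochain n) x y z (f : hom C y z) (c : chain n x y) :
  hoch_d phi x z (cons_chain f c) =
  comp f (phi x y c) - bar (fun w => @phi w z) (cons_chain f c).
Proof.
rewrite /= /hoch_d_fun /bar /head_face /last_face /= opprD -addrA.
congr (_ + (_ + _)); last by rewrite exprS mulN1r scaleNr.
case: n phi c => [|n] phi c; first by rewrite oppr0.
rewrite /= -sumrN; apply: eq_bigr => i _.
by rewrite exprS mulN1r scaleNr.
Qed.

Lemma bar_lin n z t a (psi psi' : forall w, chain n w z -> hom C w t)
    x (c : chain n.+1 x z) :
  bar (fun w c => a *: psi w c + psi' w c) c = a *: bar psi c + bar psi' c.
Proof.
rewrite /bar comp_linl !scalerDr !scalerA [_ * a]mulrC.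
rewrite (addrACA (a *: _) _ _ (_ *: comp (psi' _ _) _)); congr (_ + _).
case: n psi psi' c => [|n] psi psi' c; first by rewrite scaler0 addr0.
rewrite scaler_sumr -big_split /=; apply: eq_bigr => i _.
by rewrite scalerDr !scalerA mulrC.
Qed.

Lemma bar_sub n z t (psi psi' : forall w, chain n w z -> hom C w t)
    x (c : chain n.+1 x z) :
  bar (fun w c => psi w c - psi' w c) c = bar psi c - bar psi' c.
Proof.
rewrite [RHS]addrC -scaleN1r -bar_lin; apply: bar_eq => w e.
by rewrite scaleN1r addrC.
Qed.

Lemma bar_comp n z t u (g : hom C t u)
    (psi : forall w, chain n w z -> hom C w t) x (c : chain n.+1 x z) :
  bar (fun w c => comp g (psi w c)) c = comp g (bar psi c).
Proof.
have gD p q := linear_add (comp_linr (x := x) g) p q.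
have gZ a p := linear_scale (comp_linr (x := x) g) a p.
have g0 := linear_zero (comp_linr (x := x) g).
rewrite /bar gD gZ compA; congr (_ + _).
case: n psi c => [|n] psi c; first by rewrite g0.
by rewrite (big_morph _ gD g0); apply: eq_bigr => i _; rewrite gZ.
Qed.

Lemma bar_bar n z t (psi : forall w, chain n w z -> hom C w t)
    x y w (f : hom C y z) (g : hom C w y) (c : chain n x w) :
  bar (fun v e => bar psi (cons_chain f e)) (cons_chain g c) =
  bar psi (cons_chain (comp f g) c).
Proof.
elim: n z t psi x y w f g c => [|n IH] z t psi x y w f g c.
  by case: w / c g => g; rewrite !bar_nil compA.
case: c => v [h c]; rewrite -/(cons_chain h c) !bar_cons.
rewrite (bar_eq (psi' := fun w' e =>
  psi w' (cons_chain (comp f g) e) -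
  bar (fun v e' => psi v (cons_chain f e')) (cons_chain g e))); last first.
  by move=> w' e; rewrite bar_cons.
by rewrite bar_sub IH compA opprB addrA subrK.
Qed.

Fact hoch_dd n (phi : cochain n) : hoch_d (hoch_d phi) = 0.
Proof.
apply: cochain_eq => x z [y [f [w [g c]]]].
rewrite -/(cons_chain g c) -/(cons_chain f (cons_chain g c)) hoch_dE.
rewrite bar_cons !hoch_dE.
rewrite (bar_eq (psi' := fun v e =>
  comp f (phi v y e) - bar (fun w => @phi w z) (cons_chain f e))); last first.
  by move=> v e; rewrite hoch_dE.
rewrite bar_sub bar_comp bar_bar.
rewrite -[X in comp f (_ + X)]scaleN1r (linear_add (comp_linr f)).
rewrite (linear_scale (comp_linr f)) scaleN1r compA.
move: (bar _ (cons_chain (comp f g) c)) (comp f (bar _ _)) => D B.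
by move: (comp _ _) => A; rewrite !opprB !addrA !subrK subrr.
Qed.

Definition hoch_complex : complex k :=
  @Complex k (fun n => cochain n) (fun n => @hoch_d n) hoch_dd.

Definition HH n : lmodType k := cohomology hoch_complex n.

End Hochschild.

(* Main.v *)
From HB Require Import structures.
From mathcomp Require Import all_boot all_algebra.
From mathcomp Require Import boolp classical_sets.
Require Import Defs.

Set Implicit Arguments.
Unset Strict Implicit.
Unset Printing Implicit Defensive.
Import GRing.Theory.
Local Open Scope ring_scope.

(** Write D for the one-point extension C[M] and [new] for the added object.
    Since there is no nonzero morphism from [new] to an object of C, a string of
    composable morphisms of D on which a multilinear map can be nonzero is of
    one of three kinds: it lies in C; or it is a string of C followed by an
    element of M (a morphism into [new]); or it has a scalar (an endomorphism
    of [new]) as its outermost entry.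

    Strings of the third kind can be discarded: prepending the identity of
    [new] is a homotopy between the identity of the Hochschild complex of D and
    the projection that kills them ([glue_homotopy]).  So in positive degrees a
    cochain of D may be taken to be a pair [glue phi psi] of a cochain phi of C
    and a multilinear map psi on strings of the second kind, that is, an
    element psi of the bar complex B(M, M), where B^n(M, N) consists of the
    multilinear maps from an element of M and a string of n morphisms to N.
    The differential of a pair is
      d (phi, psi) = (d phi, m phi - d psi)        ([d_glue]),
    with (m phi)(m, c) = m phi(c), so up to homotopy the complex of D is, in
    positive degrees, a shifted mapping cone of the chain map [bar_act] from the
    Hochschild complex of C to B(M, M), and the long exact sequence is that of
    the cone.  In degree 0 there is one more component, a scalar a at [new],
    whose coboundary is - a id_M ([d_glue0]); this is why End(M) appears modulo
    scalars.

    It remains to see that B(M, N) computes Ext(M, N), for any projective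
    resolution P of M ([Ext_bar]).  Over a field, an exact sequence
    0 -> K -> P_0 -> M -> 0 splits linearly ([kernel_retraction]), so it induces
    short exact sequences of the spaces B^n(-, N); and B(P_0, N) is acyclic in
    positive degrees because P_0 is a direct summand of a free module
    ([bar_acyclic]).  Hence the cohomology of B(M, N) is that of B(K, N) shifted
    by one, just as the Ext of M is the Ext of K shifted by one, and an
    induction on the degree concludes.

    All comparisons of cohomology spaces are made by linear relations between
    representatives, as a diagram chase produces them; in this way no
    connecting map has to be chosen before it is known to be well defined. *)

(** * Subquotients and linear relations *)

Section Subquotients.
Variable k : fieldType.

(** A presentation of the quotient of the cycles [cyc] by the boundaries
    [bnd]. *)
Record subquot := SubQuot {
  sqsp :> lmodType k;
  cyc : sqsp -> Prop;
  bnd : sqsp -> Prop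
}.

Definition linrel (U V : lmodType k) (R : U -> V -> Prop) : Prop :=
  forall a u v u' v', R u v -> R u' v' -> R (a *: u + u') (a *: v + v').

(** A linear relation that induces an isomorphism of the quotients: from a cycle
    u one chases to some v, the choices affect v by a boundary only, and
    boundaries are reflected. *)
Definition sq_rel (S T : subquot) (R : S -> T -> Prop) : Prop :=
  [/\ linrel R,
      forall u v, R u v -> [/\ cyc u, cyc v & bnd u <-> bnd v],
      forall u, cyc u -> exists v, R u v
    & forall v, cyc v -> exists u, R u v].

Definition sq_iso (S T : subquot) : Prop := exists R, @sq_rel S T R.

Lemma sq_iso_trans S T W : sq_iso S T -> sq_iso T W -> sq_iso S W.
Proof.
move=> [R [lR bR tR oR]] [Q [lQ bQ tQ oQ]].
exists (fun u w => exists2 v, R u v & Q v w); split.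
- move=> a u w u' w' [v uv vw] [v' uv' vw'].
  by exists (a *: v + v'); [apply: lR | apply: lQ].
- move=> u w [v /bR [cu _ uv] /bQ [_ cw vw]]; split=> //.
  by rewrite uv vw.
- move=> u /tR [v uv]; have [_ cv _] := bR _ _ uv.
  by have [w vw] := tQ _ cv; exists w, v.
- move=> w /oQ [v vw]; have [cv _ _] := bQ _ _ vw.
  by have [u uv] := oR _ cv; exists u, v.
Qed.

(** A space presents itself, so that an [sq_iso] out of [space_sq H] says that
    H is the quotient presented on the other side. *)
Definition space_sq (H : lmodType k) : subquot :=
  SubQuot (fun _ : H => True) (fun q : H => q = 0).

Definition coh_sq (X : complex k) n : subquot :=
  SubQuot (fun u : X n => cpx_d X n u = 0) (@is_coboundary k X n).

Lemma linrelN (U V : lmodType k) (R : U -> V -> Prop) u v u' v' :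
  linrel R -> R u v -> R u' v' -> R (u - u') (v - v').
Proof.
move=> lR uv uv'; rewrite addrC -scaleN1r [v - _]addrC -[- v']scaleN1r.
exact: lR.
Qed.

Lemma lquot_sq (V : lmodType k) (S : subspace V) :
  sq_iso (space_sq (lquot S))
         (SubQuot (fun _ : V => True) (fun u => u \in subspace_mem S)).
Proof.
exists (fun q u => q = lquot_pi S u); split=> //.
- by move=> a q u q' u' -> ->; rewrite linearP.
- move=> q u ->; split=> //=.
  have e : lquot_pi S 0 = 0 by rewrite linear0.
  by rewrite -e; split => [/eqP|h]; [|apply/eqP]; rewrite lquot_pi_eq subr0.
- by move=> q _; apply: lquot_piP.
- by move=> u _; exists (lquot_pi S u).
Qed.

Lemma cohomology_sq (X : complex k) n :
  sq_iso (space_sq (cohomology X n)) (coh_sq X n).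
Proof.
apply: sq_iso_trans (lquot_sq _) _.
exists (fun (z : cocycle X n) u => kerval z = u); split=> /=.
- by move=> a u v u' v' <- <-.
- move=> u v <-; split=> //; first exact/eqP/(kervalP u).
  by split=> /asboolP.
- by move=> u _; exists (kerval u).
- by move=> u /eqP hu; exists (Kernel (hu : u \in kerp (cpx_d X n))).
Qed.

(** The map sends the class of u to the class of [t u]; the last clause
    determines it without choosing representatives. *)
Lemma sq_map (H H' : lmodType k) (S S' : subquot) (R : H -> S -> Prop)
    (R' : H' -> S' -> Prop) (t : S -> S') :
  @sq_rel (space_sq H) S R -> @sq_rel (space_sq H') S' R' -> linear t ->
  (forall u, cyc u -> cyc (t u)) -> (forall u, cyc u -> bnd u -> bnd (t u)) ->
  exists f : {linear H -> H'},
    forall q u, R q u -> forall q', R' q' (t u) -> f q = q'.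
Proof.
move=> [/= lR bR tR oR] [/= lR' bR' tR' oR'] tl tc tb.
have /boolp.choice[f fP] q : exists h, exists2 u, R q u & R' h (t u).
  have [u qu] := tR q I; have [_ cu _] := bR _ _ qu.
  by have [q' q'u] := oR' _ (tc _ cu); exists q', u.
have fE q u q' : R q u -> R' q' (t u) -> f q = q'.
  move=> qu q'u; have [v qv fv] := fP q.
  have [_ cd bar_d] := bR _ _ (linrelN lR qv qu).
  have := linrelN lR' fv q'u; rewrite -[t u]scale1r.
  have -> : t v - 1 *: t u = t (v - u).
    by rewrite scale1r addrC -scaleN1r -tl scaleN1r addrC.
  case/bR' => _ _ bd'; apply/eqP; rewrite -subr_eq0; apply/eqP.
  by apply/bd'/tb => //; apply/bar_d; rewrite subrr.
have fl : linear f.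
  move=> a q q'; have [u qu fu] := fP q; have [u' qu' fu'] := fP q'.
  by apply: (fE _ (a *: u + u')); [apply: lR | rewrite tl; apply: lR'].
pose F := GRing.isLinear.Build k H H' _ f fl.
pose G : {linear H -> H'} := HB.pack f F.
by exists G => q u qu q' q'u; apply: fE qu q'u.
Qed.

(** Exactness in the middle can be tested on representatives, where it reads:
    the image of a cycle v bounds iff v is the image of a cycle up to a
    boundary. *)
Lemma sq_exact (H H' H'' : lmodType k) (S S' S'' : subquot)
    (R : H -> S -> Prop) (R' : H' -> S' -> Prop) (R'' : H'' -> S'' -> Prop)
    (t : S -> S') (t' : S' -> S'')
    (f : {linear H -> H'}) (f' : {linear H' -> H''}) :
  @sq_rel (space_sq H) S R -> @sq_rel (space_sq H') S' R' ->
  @sq_rel (space_sq H'') S'' R'' ->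
  (forall u, cyc u -> cyc (t u)) -> (forall u, cyc u -> cyc (t' u)) ->
  (forall q u, R q u -> forall q', R' q' (t u) -> f q = q') ->
  (forall q u, R' q u -> forall q', R'' q' (t' u) -> f' q = q') ->
  (forall v, cyc v -> bnd (t' v) <-> exists2 u, cyc u & bnd (v - t u)) ->
  exact_at f f'.
Proof.
move=> [/= lR bR tR oR] [/= lR' bR' tR' oR'] [/= lR'' bR'' tR'' oR''].
move=> tc tc' fE fE' ex q.
have [v qv] := tR' q I; have [_ cv _] := bR' _ _ qv.
have [r rv] := oR'' _ (tc' _ cv); have [_ _ b''] := bR'' _ _ rv.
rewrite (fE' _ _ qv _ rv) b'' (ex _ cv); split.
  case=> u cu bu; have [p pu] := oR _ cu; exists p.
  have [p' pu'] := oR' _ (tc _ cu); rewrite (fE _ _ pu _ pu').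
  have [_ _ bd'] := bR' _ _ (linrelN lR' qv pu').
  by apply/esym/eqP; rewrite -subr_eq0; apply/eqP/bd'.
case=> p fp; have [u pu] := tR p I; have [_ cu _] := bR _ _ pu; exists u => //.
have [p' pu'] := oR' _ (tc _ cu).
have [_ _ bd'] := bR' _ _ (linrelN lR' qv pu').
by apply/bd'; rewrite -fp (fE _ _ pu _ pu') subrr.
Qed.

Lemma sq_inj (H H' : lmodType k) (S S' : subquot)
    (R : H -> S -> Prop) (R' : H' -> S' -> Prop) (t : S -> S')
    (f : {linear H -> H'}) :
  @sq_rel (space_sq H) S R -> @sq_rel (space_sq H') S' R' ->
  (forall u, cyc u -> cyc (t u)) ->
  (forall q u, R q u -> forall q', R' q' (t u) -> f q = q') ->
  (forall u, cyc u -> bnd (t u) -> bnd u) -> injective f.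
Proof.
move=> [/= lR bR tR oR] [/= lR' bR' tR' oR'] tc fE inj p q pq.
apply/eqP; rewrite -subr_eq0; apply/eqP.
have [u qu] := tR (p - q) I; have [_ cu bu] := bR _ _ qu.
have [q' q'u] := oR' _ (tc _ cu); have [_ _ bu'] := bR' _ _ q'u.
apply/bu/inj => //; apply/bu'.
by rewrite -(fE _ _ qu _ q'u) linearB pq subrr.
Qed.

End Subquotients.

(** * Linear splittings *)

Section Complement.
Variables (k : fieldType) (U V : lmodType k) (e : {linear U -> V}).

(** A maximal subspace G among those that meet the kernel trivially, given by
    Zorn's lemma, is a complement of the kernel: a vector outside the sum could
    be added to G, as nonzero scalars are invertible.  The retraction is the
    projection along G. *)
Lemma kernel_retraction :
  exists r : U -> kernel e, linear r /\ forall u : kernel e, r (kerval u) = u.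
Proof.
pose cl (G : set U) := forall a u v, G u -> G v -> G (a *: u + v).
pose P (G : set U) := cl G /\ forall u, G u -> e u = 0 -> u = 0.
have [|G [[clG Ge] Gmax]] := @Zorn_bigcup U P.
  move=> F FP Ftot; split; last by move=> u [X /FP [_]]; apply.
  move=> a u v [X FX Xu] [Y FY Yv].
  have [XY|YX] := Ftot _ _ FX FY.
    by exists Y => //; apply: (FP _ FY).1 => //; apply: XY.
  by exists X => //; apply: (FP _ FX).1 => //; apply: YX.
(* The empty set satisfies P, which makes the union of the empty chain harmless. *)
have G0 : G 0.
  apply: contrapT => nG0.
  have nG u : ~ G u.
    by move=> Gu; apply: nG0; rewrite -(addNr u) -scaleN1r; apply: clG.
  apply: (Gmax [set 0]%classic).
    by split=> [u /nG //|sub]; apply/nG0/sub.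
  by split=> [a u v -> ->|u -> //]; rewrite scaler0 addr0.
have dec u : exists g, G g /\ e (u - g) = 0.
  apply: contrapT => nu.
  pose G' : set U := fun v => exists a g, G g /\ v = a *: u + g.
  apply: (Gmax G').
    split=> [g Gg|sub]; first by exists 0, g; rewrite scale0r add0r.
    apply: nu; exists u; rewrite subrr linear0; split=> //.
    by apply: sub; exists 1, 0; rewrite scale1r addr0.
  split=> [a _ _ [b [g [Gg ->]]] [c [h [Gh ->]]]|_ [a [g [Gg ->]]] ea].
    exists (a * b + c), (a *: g + h); split; first exact: clG.
    by rewrite scalerDr scalerA scalerDl addrACA.
  have [a0|an0] := eqVneq a 0.
    by move: ea; rewrite a0 scale0r add0r; apply: Ge.
  case: nu; exists (- a^-1 *: g); split.
    by rewrite -[_ *: g]addr0; apply: clG.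
  apply: (scalerI an0); rewrite scaler0 -linearZ scalerBr scalerA.
  by rewrite mulrN divff // scaleN1r opprK.
have /boolp.choice[p pP] := dec.
have pu u g : G g -> e (u - g) = 0 -> p u = g.
  move=> Gg eg; have [Gp ep] := pP u.
  apply/eqP; rewrite -subr_eq0; apply/eqP; apply: Ge.
    by rewrite addrC -scaleN1r; apply: clG.
  rewrite -(subrKA u) addrC linearD -opprB linearN ep eg.
  by rewrite oppr0 addr0.
have kP u : u - p u \in kerp e by apply/eqP; case: (pP u).
have pl : linear p.
  move=> a u v; have [Gu eu] := pP u; have [Gv ev] := pP v.
  apply: pu; first exact: clG.
  by rewrite opprD addrACA -scalerBr linearP eu ev scaler0 addr0.
exists (fun u => Kernel (kP u)); split=> [a u v|u]; apply: val_inj => /=.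
  by rewrite pl opprD addrACA -scalerBr.
rewrite (@pu _ 0) ?subr0 //; exact/eqP/(kervalP u).
Qed.

End Complement.

Lemma linear_sub (k : fieldType) (U V : lmodType k) (f : U -> V) u v :
  linear f -> f (u - v) = f u - f v.
Proof.
by move=> fl; rewrite addrC -scaleN1r fl scaleN1r addrC.
Qed.

(** * The bar complex of a module *)

Section DependentProduct.
Variables (k : fieldType) (I : Type) (V : I -> lmodType k).

(** An alias of the dependent product, to carry its vector space structure.
    Elements of nested products are still applied like ordinary functions of
    several variables. *)
Definition dprod := forall i, V i.

Lemma dprod_eq (f g : dprod) : (forall i, f i = g i) -> f = g.
Proof. exact: functional_extensionality_dep. Qed.

HB.instance Definition _ := gen_eqMixin dprod.
HB.instance Definition _ := gen_choiceMixin dprod.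

Definition dprod0 : dprod := fun i => 0.
Definition dprodD (f g : dprod) : dprod := fun i => f i + g i.
Definition dprodZ a (f : dprod) : dprod := fun i => a *: f i.

Fact dprodDA : associative dprodD.
Proof. by move=> f g h; apply: dprod_eq => i; apply: addrA. Qed.
Fact dprodDC : commutative dprodD.
Proof. by move=> f g; apply: dprod_eq => i; apply: addrC. Qed.
Fact dprod0D : left_id dprod0 dprodD.
Proof. by move=> f; apply: dprod_eq => i; apply: add0r. Qed.
Fact dprodND : left_inverse dprod0 (dprodZ (-1)) dprodD.
Proof.
by move=> f; apply: dprod_eq => i; rewrite /dprodD /dprodZ scaleN1r addNr.
Qed.
HB.instance Definition _ :=
  GRing.isZmodule.Build dprod dprodDA dprodDC dprod0D dprodND.

Fact dprodZA a b f : dprodZ a (dprodZ b f) = dprodZ (a * b) f.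
Proof. by apply: dprod_eq => i; apply: scalerA. Qed.
Fact dprod1Z : left_id 1 dprodZ.
Proof. by move=> f; apply: dprod_eq => i; apply: scale1r. Qed.
Fact dprodZDr : right_distributive dprodZ +%R.
Proof. by move=> a f g; apply: dprod_eq => i; apply: scalerDr. Qed.
Fact dprodZDl f : {morph dprodZ^~ f : a b / a + b}.
Proof. by move=> a b; apply: dprod_eq => i; apply: scalerDl. Qed.
HB.instance Definition _ := GRing.Zmodule_isLmodule.Build k dprod
  dprodZA dprod1Z dprodZDr dprodZDl.

End DependentProduct.

Section Bar.
Variables (k : fieldType) (C : lincat k) (N : rmod C).

(** The analogue of [bar] with values in a module N: the alternating sum of the
    faces of (f_1, ..., f_n+1) other than the leading one, the last face being
    the action of f_n+1.  The recursion on the first entry is the identity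
    [bar_cons]. *)
Fixpoint mbar n z : (forall w, chain n w z -> N w) ->
    forall x, chain n.+1 x z -> N x :=
  match n return (forall w, chain n w z -> N w) ->
                 forall x, chain n.+1 x z -> N x with
  | 0 => fun psi x c =>
      act (psi z erefl) (ecast w (hom C w z) (esym (projT2 c).2) (projT2 c).1)
  | m.+1 => fun psi x c =>
      psi x (merge_head c)
      - mbar (fun w c' => psi w (cons_chain (projT2 c).1 c')) (projT2 c).2
  end.

Lemma mbar_nil z y (psi : forall w, chain 0 w z -> N w) (f : hom C y z) :
  mbar psi (cons_chain f (erefl y : chain 0 y y)) = act (psi z erefl) f.
Proof. by []. Qed.

Lemma mbar_cons n z (psi : forall w, chain n.+1 w z -> N w) x y w
    (f : hom C y z) (g : hom C w y) (c : chain n x w) :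
  mbar psi (cons_chain f (cons_chain g c)) =
  psi x (cons_chain (comp f g) c)
  - mbar (fun w c => psi w (cons_chain f c)) (cons_chain g c).
Proof. by []. Qed.

Lemma mbar_eq n z (psi psi' : forall w, chain n w z -> N w) :
  (forall w c, psi w c = psi' w c) ->
  forall x (c : chain n.+1 x z), mbar psi c = mbar psi' c.
Proof.
move=> e x c; congr (mbar _ c).
by apply: functional_extensionality_dep => w; apply/funext.
Qed.

Lemma mbar_lin n z a (psi psi' : forall w, chain n w z -> N w)
    x (c : chain n.+1 x z) :
  mbar (fun w c => a *: psi w c + psi' w c) c = a *: mbar psi c + mbar psi' c.
Proof.
elim: n z psi psi' x c => [|n IH] z psi psi' x c /=; first by rewrite act_linl.
by rewrite IH opprD scalerBr addrACA.
Qed.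

Lemma mbar_sub n z (psi psi' : forall w, chain n w z -> N w)
    x (c : chain n.+1 x z) :
  mbar (fun w c => psi w c - psi' w c) c = mbar psi c - mbar psi' c.
Proof.
rewrite [RHS]addrC -scaleN1r -mbar_lin; apply: mbar_eq => w e.
by rewrite scaleN1r addrC.
Qed.

Lemma mbar0 n z x (c : chain n.+1 x z) : mbar (fun w _ => 0 : N w) c = 0.
Proof.
rewrite (mbar_eq (psi' := fun w _ => 0 - 0)) ?mbar_sub ?subrr // => w _.
by rewrite subrr.
Qed.

(** The operation psi . f = [mbar psi (cons_chain f _)] on multilinear maps is
    associative; this is what makes the square of the differential vanish. *)
Lemma mbar_mbar n z (psi : forall w, chain n w z -> N w)
    x y w (f : hom C y z) (g : hom C w y) (c : chain n x w) :
  mbar (fun v e => mbar psi (cons_chain f e)) (cons_chain g c) =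
  mbar psi (cons_chain (comp f g) c).
Proof.
elim: n z psi x y w f g c => [|n IH] z psi x y w f g c.
  by case: w / c g => g; rewrite !mbar_nil actA.
case: c => v [h c]; rewrite -/(cons_chain h c) !mbar_cons.
rewrite (mbar_eq (psi' := fun w' e =>
  psi w' (cons_chain (comp f g) e) -
  mbar (fun v e' => psi v (cons_chain f e')) (cons_chain g e))) //.
by rewrite mbar_sub IH compA opprB addrA subrK.
Qed.

Lemma mbar_ml n z (psi : forall w, chain n w z -> N w) x :
  (forall w, multilinear (psi w)) -> multilinear (fun c => mbar psi (x := x) c).
Proof.
elim: n z psi => [|n IH] z psi hpsi.
  by move=> y; split=> // c a f g; case: y / c f g => f g /=; apply: act_linr.
apply: ml_add.
  by case: n {IH} psi hpsi => [|n] psi hpsi; apply: (ml_merge 0 (hpsi x)).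
rewrite (_ : (fun _ => _) = (fun c => -1 *: mbar (fun w c' =>
   psi w (cons_chain (projT2 c).1 c')) (projT2 c).2)); last first.
  by rewrite funeqE => c; rewrite scaleN1r.
apply: ml_scale => y; split=> [c a f g|f]; last first.
  have hf w : multilinear (fun c => psi w (cons_chain f c)) := (hpsi w y).2 f.
  exact: (IH y (fun w c => psi w (cons_chain f c)) hf).
by rewrite /= -mbar_lin; apply: mbar_eq => w e; case: (hpsi w y) => ->.
Qed.

End Bar.

Section BarComplex.
Variables (k : fieldType) (C : lincat k) (M N : rmod C).

Definition bar_space n := dprod (fun x : C => dprod (fun y : C =>
  dprod (fun m : M y => dprod (fun c : chain n x y => N x)))).

Definition bar_mem n : {pred bar_space n} := fun phi =>
  `[< forall x y, (forall c, linear (fun m => phi x y m c)) /\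
                  (forall m, multilinear (phi x y m)) >].
Arguments bar_mem : clear implicits.

Fact bar_mem_closed n : submod_closed (bar_mem n).
Proof.
split=> [|a f g /asboolP hf /asboolP hg]; apply/asboolP => x y; split.
- by move=> c a m m'; rewrite /= scaler0 addr0.
- by move=> m; apply: ml_zero.
- move=> c b m m'; have [[hf1 _] [hg1 _]] := (hf x y, hg x y).
  change (a *: f x y (b *: m + m') c + g x y (b *: m + m') c =
    b *: (a *: f x y m c + g x y m c) + (a *: f x y m' c + g x y m' c)).
  rewrite hf1 hg1 !scalerDr !scalerA mulrC.
  by rewrite -!addrA; congr (_ + _); rewrite addrCA.
- move=> m; have [[_ hf2] [_ hg2]] := (hf x y, hg x y).
  exact: ml_add (ml_scale a (hf2 m)) (hg2 m).
Qed.
HB.instance Definition _ n :=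
  GRing.isSubmodClosed.Build k (bar_space n) (bar_mem n) (bar_mem_closed n).

Record bcochain n := BCochain_ { bval : bar_space n; bvalP : bval \in bar_mem n }.
HB.instance Definition _ n := [isSub for @bval n].
HB.instance Definition _ n := [Choice of bcochain n by <:].
HB.instance Definition _ n := [SubChoice_isSubLmodule of bcochain n by <:].

Definition bfun n (phi : bcochain n) x y (m : M y) (c : chain n x y) : N x :=
  bval phi m c.

Lemma bfun_lin n (phi : bcochain n) x y (c : chain n x y) :
  linear (fun m => bfun phi m c).
Proof. by have /asboolP /(_ x y) [] := bvalP phi. Qed.

Lemma bfun_ml n (phi : bcochain n) x y (m : M y) :
  multilinear (fun c : chain n x y => bfun phi m c).
Proof. by have /asboolP /(_ x y) [] := bvalP phi. Qed.

Lemma bfun_linear n x y (m : M y) (c : chain n x y) a (phi psi : bcochain n) :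
  bfun (a *: phi + psi) m c = a *: bfun phi m c + bfun psi m c.
Proof. by []. Qed.

Lemma bfun_sub n x y (m : M y) (c : chain n x y) (phi psi : bcochain n) :
  bfun (phi - psi) m c = bfun phi m c - bfun psi m c.
Proof. exact: (linear_sub (f := fun phi => bfun phi m c)). Qed.

Lemma bcochain_eq n (phi psi : bcochain n) :
  (forall x y (m : M y) (c : chain n x y), bfun phi m c = bfun psi m c) ->
  phi = psi.
Proof.
move=> e; apply: val_inj; apply: dprod_eq => x; apply: dprod_eq => y.
by apply: dprod_eq => m; apply: dprod_eq => c; apply: e.
Qed.

Definition BCochain n (phi : forall x y, M y -> chain n x y -> N x)
  (hlin : forall x y c, linear (fun m => phi x y m c))
  (hml : forall x y m, multilinear (phi x y m)) : bcochain n :=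
  BCochain_ (bval := phi) (introT (asboolP _) (fun x y => conj (hlin x y) (hml x y))).

(** d phi (m, f_1, ..., f_n+1) = phi (m f_1, f_2, ..., f_n+1)
       - phi (m, f_1 f_2, ...) + ... *)
Definition bar_d_fun n (phi : bcochain n) x y (m : M y) (c : chain n.+1 x y) : N x :=
  bfun phi (act m (projT2 c).1) (projT2 c).2
  - mbar (fun w => bfun phi (x := w) m) c.

Fact bar_d_lin n (phi : bcochain n) x y (c : chain n.+1 x y) :
  linear (fun m => bar_d_fun phi m c).
Proof.
move=> a m m'; rewrite /bar_d_fun act_linl bfun_lin scalerBr addrACA -opprD.
by rewrite -mbar_lin; congr (_ - _); apply: mbar_eq => w e; rewrite bfun_lin.
Qed.

Fact bar_d_ml n (phi : bcochain n) x y (m : M y) :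
  multilinear (fun c : chain n.+1 x y => bar_d_fun phi m c).
Proof.
apply: ml_add => [w|].
  split=> [c a f g|f] /=; first by rewrite act_linr bfun_lin.
  exact: bfun_ml.
rewrite (_ : (fun _ => _) = (fun c : chain n.+1 x y =>
   -1 *: mbar (fun w => bfun phi (x := w) m) c)); last first.
  by rewrite funeqE => c; rewrite scaleN1r.
by apply/ml_scale/mbar_ml => w; apply: bfun_ml.
Qed.

Definition bar_d n (phi : bcochain n) : bcochain n.+1 :=
  BCochain (bar_d_lin phi) (@bar_d_ml n phi).

Lemma bar_dE n (phi : bcochain n) x y z (m : M z) (f : hom C y z) (c : chain n x y) :
  bfun (bar_d phi) m (cons_chain f c) =
  bfun phi (act m f) c - mbar (fun w => bfun phi (x := w) m) (cons_chain f c).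
Proof. by []. Qed.

Fact bar_d_linear n : linear (@bar_d n).
Proof.
move=> a phi psi; apply: bcochain_eq => x y m [z [f c]].
rewrite bfun_linear -/(cons_chain f c) !bar_dE scalerBr addrACA -opprD -mbar_lin.
by [].
Qed.
HB.instance Definition _ n := GRing.isLinear.Build k _ _ _ _ (@bar_d_linear n).

Lemma bar_d_sub n (phi psi : bcochain n) :
  bar_d (phi - psi) = bar_d phi - bar_d psi.
Proof. exact: linear_sub (@bar_d_linear n). Qed.

Fact bar_dd n (phi : bcochain n) : bar_d (bar_d phi) = 0.
Proof.
apply: bcochain_eq => x z m [y [f [w [g c]]]].
rewrite -/(cons_chain g c) -/(cons_chain f (cons_chain g c)) bar_dE.
have e : mbar (fun v e => bfun (bar_d phi) m (cons_chain f e)) (cons_chain g c) =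
    mbar (fun v => bfun phi (x := v) (act m f)) (cons_chain g c)
    - mbar (fun v => bfun phi (x := v) m) (cons_chain (comp f g) c).
  by rewrite -mbar_mbar -mbar_sub; apply: mbar_eq => v d; rewrite bar_dE.
rewrite mbar_cons e !bar_dE actA; apply/eqP; rewrite subr_eq0; apply/eqP.
by rewrite opprB addrA subrK.
Qed.

Definition bar_complex : complex k :=
  @Complex k (fun n => bcochain n) (fun n => @bar_d n) bar_dd.

End BarComplex.

Section Pull.
Variables (k : fieldType) (C : lincat k).

Definition bpull (M M' N : rmod C) n (f : forall y, M y -> M' y)
    (hf : forall y, linear (f y)) (phi : bcochain M' N n) : bcochain M N n.
Proof.
apply: (@BCochain k C M N n (fun x y m c => bfun phi (f y m) c)) => x y.
- by move=> c a m m'; rewrite hf bfun_lin.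
- by move=> m; apply: bfun_ml.
Defined.

Lemma bpullE (M M' N : rmod C) n (f : forall y, M y -> M' y)
    (hf : forall y, linear (f y)) (phi : bcochain M' N n) x y (m : M y)
    (c : chain n x y) : bfun (bpull hf phi) m c = bfun phi (f y m) c.
Proof. by []. Qed.

Definition mpull (M M' N : rmod C) n (f : modhom M M') :
  bcochain M' N n -> bcochain M N n := bpull (@mfun_lin _ _ _ _ f).

Lemma mpull_d (M M' N : rmod C) n (f : modhom M M') (phi : bcochain M' N n) :
  mpull f (bar_d phi) = bar_d (mpull f phi).
Proof.
apply: bcochain_eq => x z m [y [g c]]; rewrite -/(cons_chain g c) bar_dE.
by rewrite !bpullE bar_dE mfun_act.
Qed.

End Pull.

(** * Acyclicity for projective modules *)

(** Multilinear maps on strings of length n+1 ending at x, on which C acts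
    through the outermost entry: this is the module coinduced from the vector
    spaces of multilinear maps on strings of length n. *)
Section Coinduced.
Variables (k : fieldType) (C : lincat k) (N : rmod C) (n : nat).

Section Carrier.
Variable x : C.

Definition coind_space :=
  dprod (fun w : C => dprod (fun c : chain n.+1 w x => N w)).

Definition coind_mem : {pred coind_space} :=
  fun a => `[< forall w, multilinear (a w) >].

Fact coind_closed : submod_closed coind_mem.
Proof.
split=> [|c f g /asboolP hf /asboolP hg]; apply/asboolP => w.
  exact: ml_zero.
exact: ml_add (ml_scale c (hf w)) (hg w).
Qed.
HB.instance Definition _ :=
  GRing.isSubmodClosed.Build k coind_space coind_mem coind_closed.

Record coind := Coind { coval : coind_space; covalP : coval \in coind_mem }.
HB.instance Definition _ := [isSub for coval].
HB.instance Definition _ := [Choice of coind by <:].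
HB.instance Definition _ := [SubChoice_isSubLmodule of coind by <:].

Lemma coind_ml (a : coind) w : multilinear (coval a (i := w)).
Proof. by have /asboolP := covalP a. Qed.

Lemma coind_eq (a b : coind) :
  (forall w (c : chain n.+1 w x), coval a c = coval b c) -> a = b.
Proof.
by move=> e; apply: val_inj; apply: dprod_eq => w; apply: dprod_eq => c; apply: e.
Qed.

End Carrier.

Definition coind_act x y (a : coind x) (g : hom C y x) : coind y.
Proof.
exists (fun w c => coval a (cons_chain (comp g (projT2 c).1) (projT2 c).2)).
apply/asboolP => w z; split=> [c b f f'|f].
  by rewrite /= comp_linr ((coind_ml a w z).1 c).
exact: ((coind_ml a w z).2 (comp g f)).
Defined.

Definition coind_mod : rmod C.
Proof.
apply: (@RMod k C coind coind_act).
- by move=> x y f a m m'; apply: coind_eq.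
- move=> x y m a f g; apply: coind_eq => w [z [h c]].
  by rewrite /= comp_linl ((coind_ml m w z).1 c).
- by move=> x y z m f g; apply: coind_eq => w [v [h c]]; rewrite /= compA.
- by move=> x m; apply: coind_eq => w [z [h c]]; rewrite /= comp1m.
Defined.

End Coinduced.

Section Acyclic.
Variables (k : fieldType) (C : lincat k) (P N : rmod C).
Hypothesis Pproj : projective P.

(** On a free module, spanned by products e g of a generator and a morphism,
    h phi (e g, c) = phi (e, g :: c) is a contracting homotopy.  Since P is
    projective it has a section s into the free module on its elements, and
    p |-> h phi (s p, _) bounds phi.  The map h phi is well defined on the free
    module because it is induced by a family of elements of a coinduced
    module. *)
Lemma bar_acyclic n (phi : bcochain P N n.+1) :
  bar_d phi = 0 -> exists psi : bcochain P N n, bar_d psi = phi.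
Proof.
move=> dphi.
have [s sP] := Pproj (e := free_aug P) (modid P) (@free_aug_surj _ _ P).
pose T := coind_mod N n.
have hP y (m : P y) : (fun w => bfun phi (x := w) m) \in @coind_mem k C N n y.
  by apply/asboolP => w; apply: bfun_ml.
pose h y (m : P y) : T y := Coind (hP y m).
pose G : modhom (free_mod P) T := free_map h.
pose ev y (q : free_mod P y) w (c : chain n w y) : N w :=
  coval (G y q) (cons_chain (idm C y) c).
(* The map G is h phi before the first entry is set to the identity; K y q is
   the identity d (h phi) = phi at the element q, checked on generators. *)
have evml y q w : multilinear (@ev y q w).
  exact: (coind_ml (G y q) w y).2.
pose K y (q : free_mod P y) := forall w z (f : hom C z y) (c : chain n w z),
    coval (G y q) (cons_chain f c) - mbar (ev y q) (cons_chain f c) =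
    bfun phi (free_aug P y q) (cons_chain f c).
have evlin y a (q q' : free_mod P y) w (c : chain n w y) :
    ev y (a *: q + q') w c = a *: ev y q w c + ev y q' w c.
  by rewrite /ev mfun_lin.
have Klin y a (q q' : free_mod P y) : K y q -> K y q' -> K y (a *: q + q').
  move=> Kq Kq' w z f c; rewrite [free_aug P y _]mfun_lin bfun_lin -Kq -Kq'.
  rewrite scalerBr addrACA -opprD -mbar_lin; congr (_ - _).
    by rewrite mfun_lin.
  by apply: mbar_eq => v d; rewrite evlin.
have K0 y : K y 0.
  move=> w z f c; rewrite (linear_zero (@mfun_lin _ _ _ _ G y)).
  rewrite (linear_zero (@mfun_lin _ _ _ _ (free_aug P) y)).
  rewrite (linear_zero (bfun_lin phi _)) sub0r (mbar_eq (psi' := fun _ _ => 0)).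
    by rewrite mbar0 oppr0.
  by move=> v d; rewrite /ev (linear_zero (@mfun_lin _ _ _ _ G y)).
have key y (q : free_mod P y) : K y q.
  elim/free_ind: q => t; elim: t => [|u m g|s1 IH1 s2 IH2|a t IH].
  - exact: K0.
  - move=> w z f c.
    have Gg v (d : chain n.+1 v y) :
        coval (G y (fpi (FGen m g))) d =
        bfun phi m (cons_chain (comp g (projT2 d).1) (projT2 d).2).
      by rewrite /= fev_pi.
    rewrite Gg [free_aug P y _]fev_pi /= (mbar_eq (psi' := fun v d =>
      bfun phi m (cons_chain g d))); last first.
      by move=> v d; rewrite /ev Gg /= compm1.
    move: (congr1 (fun b => bfun b m (cons_chain g (cons_chain f c))) dphi).
    rewrite bar_dE mbar_cons => e.
    by apply/esym/eqP; rewrite -subr_eq0; apply/eqP.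
  - have -> : fpi (FAdd s1 s2) = 1 *: fpi s1 + fpi s2 :> free_mod P y.
      by apply: free_eq => D l; rewrite fev_linear !fev_pi scale1r.
    exact: Klin.
  - have -> : fpi (FScale a t) = a *: fpi t + 0 :> free_mod P y.
      by apply: free_eq => D l; rewrite addr0 fevZ !fev_pi.
    exact: Klin.
have psi_lin x y (c : chain n x y) : linear (fun m : P y => ev y (s y m) x c).
  by move=> a m m'; rewrite /ev !mfun_lin.
exists (BCochain psi_lin (fun x y m => evml y (s y m) x)).
apply: bcochain_eq => x z m [y [f c]]; rewrite -/(cons_chain f c) bar_dE.
have sm : free_aug P z (s z m) = m := congr1 (fun r : modhom P P => r z m) sP.
rewrite -[in RHS]sm -key; congr (_ - _).
by rewrite /bfun /= /ev !mfun_act /= compm1.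
Qed.
End Acyclic.

(** * The bar complex computes Ext *)

(** Strings of length 0 are equality proofs, so bar cochains of degree 0 are
    just families of linear maps, and the cocycles among them are the module
    morphisms. *)
Section DegreeZero.
Variables (k : fieldType) (C : lincat k) (M N : rmod C).

Definition bcochain0 (g : forall y, M y -> N y) (hg : forall y, linear (g y)) :
  bcochain M N 0.
Proof.
apply: (@BCochain k C M N 0 (fun x y m c => ecast y (N y) (esym c) (g y m))) => x y.
- by case: y / => a m m'; rewrite /= hg.
- by [].
Defined.

Lemma bar_d0E (w : bcochain M N 0) x y (m : M y) (f : hom C x y) :
  bfun (bar_d w) m (cons_chain f (erefl x : chain 0 x x)) =
  bfun w (act m f) erefl - act (bfun w m erefl) f.
Proof. by []. Qed.

Lemma bar_d0_eq0 (w : bcochain M N 0) :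
  bar_d w = 0 <-> forall x y (m : M y) (f : hom C x y),
                 bfun w (act m f) erefl = act (bfun w m erefl) f.
Proof.
split=> [w0 x y m f|h].
  by apply/eqP; rewrite -subr_eq0 -bar_d0E w0.
apply: bcochain_eq => x z m [y [f c]].
by case: y / c f => f; rewrite [LHS]bar_d0E h subrr.
Qed.

Lemma bcochain0_eq (w w' : bcochain M N 0) :
  (forall x (m : M x), bfun w m erefl = bfun w' m erefl) -> w = w'.
Proof. by move=> e; apply: bcochain_eq => x y m c; case: y / c m. Qed.

Lemma bar_d0_modhom (w : bcochain M N 0) :
  bar_d w = 0 -> exists g : modhom M N, forall x m, g x m = bfun w m erefl.
Proof.
move=> /bar_d0_eq0 w0.
by exists (@ModHom k C M N _ (fun x => bfun_lin w erefl) (fun x y m => w0 y x m)).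
Qed.

End DegreeZero.

Section Shift.
Variables (k : fieldType) (C : lincat k) (L M N : rmod C) (e : modhom L M).
Hypothesis e_surj : forall x (m : M x), exists p, e x p = m.
Let K := ker_mod e.
Let i : modhom K L := ker_incl e.

Fact mpull_linear (A B : rmod C) (f : modhom A B) n :
  linear (@mpull k C A B N n f).
Proof. by move=> a phi psi; apply: bcochain_eq. Qed.

Lemma mpull_inj n : injective (@mpull k C L M N n e).
Proof.
move=> v v' vv'; apply: bcochain_eq => x y m c; have [p <-] := e_surj m.
exact: (congr1 (fun w => bfun w p c) vv').
Qed.

Lemma mpull_ker_mpull n (v : bcochain M N n) : mpull i (mpull e v) = 0.
Proof.
apply: bcochain_eq => x y p c; rewrite !bpullE.
have -> : e y (i y p) = 0 by apply/ker_inclP; exists p.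
exact: (linear_zero (bfun_lin v c)).
Qed.

(** With [mpull_extend] below: B^n(-, N) is exact on 0 -> K -> L -> M -> 0. *)
Lemma mpull_factor n (w : bcochain L N n) :
  mpull i w = 0 -> exists v, mpull e v = w.
Proof.
move=> w0; pose s y (m : M y) : L y := projT1 (cid (e_surj m)).
have sP y (m : M y) : e y (s y m) = m := projT2 (cid (e_surj m)).
have kw x y p p' (c : chain n x y) : e y p = e y p' -> bfun w p c = bfun w p' c.
  move=> pp'; apply/eqP; rewrite -subr_eq0; apply/eqP.
  rewrite -(linear_sub _ _ (bfun_lin w c)).
  have /ker_inclP[q <-] : e y (p - p') = 0.
    by rewrite (linear_sub _ _ (@mfun_lin _ _ _ _ e y)) pp' subrr.
  exact: (congr1 (fun b => bfun b q c) w0).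
have vl x y (c : chain n x y) : linear (fun m => bfun w (s y m) c).
  by move=> a m m'; rewrite -bfun_lin; apply: kw; rewrite mfun_lin !sP.
exists (BCochain vl (fun x y m => @bfun_ml _ _ _ _ _ w x y (s y m))).
by apply: bcochain_eq => x y p c; apply: kw; rewrite sP.
Qed.

Lemma mpull_extend n (u : bcochain K N n) : exists w, mpull i w = u.
Proof.
pose elin y : {linear L y -> M y} := e y.
pose r y := projT1 (cid (kernel_retraction (elin y))).
have [rl rP] : (forall y, linear (r y)) /\ (forall y u, r y (kerval u) = u).
  by split=> y; case: (projT2 (cid (kernel_retraction (elin y)))).
exists (@bpull k C L K N n (fun y => r y) rl u).
by apply: bcochain_eq => x y p c; rewrite !bpullE rP.
Qed.

Hypothesis L_proj : projective L.

(** The connecting isomorphism of the short exact sequence of complexes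
    0 -> B(M, N) -> B(L, N) -> B(K, N) -> 0, as L contributes no cohomology in
    positive degrees. *)
Lemma bar_shift n : 
  sq_iso (coh_sq (bar_complex K N) n.+1) (coh_sq (bar_complex M N) n.+2).
Proof.
exists (fun u v => exists w : bcochain L N n.+1,
  [/\ mpull i w = u, bar_d w = mpull e v, bar_d u = 0 & bar_d v = 0]); split=> /=.
- move=> a u v u' v' [w [wu wv du dv]] [w' [wu' wv' du' dv']].
  exists (a *: w + w'); split.
  + by rewrite mpull_linear wu wu'.
  + by rewrite bar_d_linear mpull_linear wv wv'.
  + by rewrite bar_d_linear du du' scaler0 addr0.
  + by rewrite bar_d_linear dv dv' scaler0 addr0.
- move=> u v [w [wu wv du dv]]; split=> //; split.
  + case=> u' u'E; have [w' w'u'] := mpull_extend u'.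
    have [|t tE] := @mpull_factor _ (w - bar_d w').
      by rewrite (linear_sub _ _ (@mpull_linear _ _ i _)) mpull_d w'u' u'E wu subrr.
    exists t; apply: mpull_inj; rewrite mpull_d tE bar_d_sub bar_dd subr0.
    exact: wv.
  + case=> t tE.
    have [|w' w'E] := @bar_acyclic k C L N L_proj n (w - mpull e t).
      by rewrite bar_d_sub -mpull_d tE wv subrr.
    exists (mpull i w'); rewrite -mpull_d w'E.
    by rewrite (linear_sub _ _ (@mpull_linear _ _ i _)) mpull_ker_mpull subr0.
- move=> u du; have [w wu] := mpull_extend u.
  have [|v vE] := @mpull_factor _ (bar_d w); first by rewrite mpull_d wu.
  exists v, w; split=> //; apply: mpull_inj; rewrite mpull_d vE bar_dd.
  by apply: bcochain_eq.
- move=> v dv; have [|w wv] := @bar_acyclic k C L N L_proj n.+1 (mpull e v).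
    by rewrite -mpull_d dv; apply: bcochain_eq.
  by exists (mpull i w), w; split=> //; rewrite -mpull_d wv mpull_ker_mpull.
Qed.

End Shift.

Lemma ker_mod_eq (k : fieldType) (C : lincat k) (L M : rmod C)
    (e : modhom L M) x (p q : ker_mod e x) : kerval p = kerval q -> p = q.
Proof. by move=> pq; apply: (@val_inj _ _ (kernel (e x))). Qed.

Section ResolutionShift.
Variables (k : fieldType) (C : lincat k) (M : rmod C) (P : proj_resolution M).

Let K := ker_mod (pres_aug P).

Fact shift_aug_subproof x (p : P 1%N x) :
  pres_d P 0 x p \in kerp (pres_aug P x).
Proof. by apply/eqP/pres_exact0; exists p. Qed.

Definition shift_aug : modhom (P 1%N) K.
Proof.
exists (fun x p => Kernel (shift_aug_subproof p) : K x).
- by move=> x a p q; apply: val_inj; rewrite /= mfun_lin.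
- by move=> x y p f; apply: val_inj; rewrite /= mfun_act.
Defined.

(** A resolution of M without its term of degree 0 resolves the first syzygy. *)
Definition shift_resolution : proj_resolution K.
Proof.
apply: (@ProjResolution k C K (fun n => P n.+1) (fun n => pres_d P n.+1) shift_aug).
- by move=> n; apply: pres_projective.
- move=> x m; have /pres_exact0[q qE] : pres_aug P x (kerval m) = 0.
    exact/eqP/(kervalP m).
  exists q; apply: ker_mod_eq; exact: qE.
- move=> x p; rewrite -pres_exact; split=> [/(congr1 (@kerval _ _ _ _)) //|h].
  exact: ker_mod_eq.
- by move=> n x p; apply: pres_exact.
Defined.

Lemma hom_shift N n :
  sq_iso (coh_sq (hom_complex P N) n.+2)
         (coh_sq (hom_complex shift_resolution N) n.+1).
Proof.
exists (fun u v => u = v /\ precomp u = 0); split=> /=.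
- move=> a u v u' v' [-> hu] [-> hu']; split=> //.
  by rewrite precomp_linear hu hu' scaler0 addr0.
- by move=> u v [-> hv].
- by move=> u hu; exists u.
- by move=> u hu; exists u.
Qed.

(** The first step of the induction.  A 1-cocycle f on P_1 is a morphism from
    the syzygy K to N; extended to a linear map w on P_0, its failure to be a
    morphism is the bar cocycle v on M. *)
Lemma Ext1_bar N :
  sq_iso (coh_sq (hom_complex P N) 1) (coh_sq (bar_complex M N) 1).
Proof.
pose e := pres_aug P; pose d0 := pres_d P 0.
have e_surj := @pres_aug_surj k C M P.
exists (fun (f : modhom (P 1%N) N) v => exists w : bcochain (P 0) N 0,
  [/\ forall x p, bfun w (d0 x p) erefl = f x p, bar_d w = mpull e v,
      precomp f = 0 & bar_d v = 0]); split=> /=.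
- move=> a u v u' v' [w [wu wv du dv]] [w' [wu' wv' du' dv']].
  exists (a *: w + w'); split.
  + by move=> x p; rewrite bfun_linear wu wu'.
  + by rewrite bar_d_linear mpull_linear wv wv'.
  + by rewrite precomp_linear du du' scaler0 addr0.
  + by rewrite bar_d_linear dv dv' scaler0 addr0.
- move=> f v [w [wf wv df dv]]; split=> //; split.
  + case=> g gf; pose w' := bcochain0 (@mfun_lin _ _ _ _ g).
    have dw' : bar_d w' = 0 by apply/bar_d0_eq0 => x y m h; apply: mfun_act.
    have [|t tE] := @mpull_factor _ _ _ _ _ e e_surj _ (w - w').
      apply: bcochain0_eq => x p.
      have /pres_exact0[q qE] : e x (ker_incl e x p) = 0 by apply/ker_inclP; exists p.
      by rewrite bpullE bfun_sub -qE -[pres_d P 0 x q]/(d0 x q) wf -gf subrr.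
    exists t; apply: (mpull_inj e_surj); rewrite mpull_d tE.
    by rewrite bar_d_sub dw' subr0.
  + case=> t tE; have [|g gE] := @bar_d0_modhom _ _ _ _ (w - mpull e t).
      by rewrite bar_d_sub -mpull_d tE wv subrr.
    exists g; apply: modhom_eq => x p; rewrite /= gE.
    rewrite -/d0 bfun_sub bpullE.
    have -> : e x (d0 x p) = 0 by apply/pres_exact0; exists p.
    by rewrite (linear_zero (bfun_lin t _)) subr0 wf.
  (* f factors through the image K of P_1 in P_0. *)
- move=> f df.
  have f0 x p : d0 x p = 0 -> f x p = 0.
    move=> /pres_exact[q <-].
    exact: (congr1 (fun h : modhom (P 2%N) N => h x q) df).
  have fE x p p' : d0 x p = d0 x p' -> f x p = f x p'.
    move=> pp'; apply/eqP; rewrite -subr_eq0; apply/eqP.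
    rewrite -(linear_sub _ _ (@mfun_lin _ _ _ _ f x)); apply: f0.
    by rewrite (linear_sub _ _ (@mfun_lin _ _ _ _ d0 x)) pp' subrr.
  pose s x (q : ker_mod e x) : P 1%N x :=
    projT1 (cid (@pres_aug_surj _ _ _ shift_resolution x q)).
  have sP x q : d0 x (s x q) = kerval q.
    have := projT2 (cid (@pres_aug_surj _ _ _ shift_resolution x q)).
    exact: (congr1 (@kerval _ _ _ _)).
  have ul x : linear (fun q => f x (s x q)).
    by move=> a q q'; rewrite -mfun_lin; apply: fE; rewrite mfun_lin !sP.
  have [w wu] := mpull_extend (bcochain0 ul).
  have wf x p : bfun w (d0 x p) erefl = f x p.
    have := congr1 (fun b : bcochain _ _ 0 => bfun b (shift_aug x p) erefl) wu.
    by rewrite bpullE /= => ->; apply: fE; rewrite sP.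
  have [|v vE] := @mpull_factor _ _ _ _ _ e e_surj _ (bar_d w).
    rewrite mpull_d; apply/bar_d0_eq0 => x y q h; rewrite !bpullE.
    have sq : ker_incl e y q = d0 y (s y q) by rewrite sP.
    by rewrite (mfun_act (ker_incl e)) sq -mfun_act !wf mfun_act.
  exists v, w; split=> //; apply: (mpull_inj e_surj); rewrite mpull_d vE bar_dd.
  exact: bcochain_eq.
- move=> v dv; have P0_proj := @pres_projective k C M P 0.
  have [|w wv] := @bar_acyclic k C (P 0) N P0_proj 0 (mpull e v).
    by rewrite -mpull_d dv; apply: bcochain_eq.
  have ed x p : e x (d0 x p) = 0 by apply/pres_exact0; exists p.
  have fl x : linear (fun p => bfun w (d0 x p) erefl).
    by move=> a p p'; rewrite mfun_lin bfun_lin.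
  have fa x y p (h : hom C y x) :
      bfun w (d0 y (act p h)) erefl = act (bfun w (d0 x p) erefl) h.
    apply/eqP; rewrite -subr_eq0 mfun_act -bar_d0E wv bpullE ed.
    by rewrite (linear_zero (bfun_lin v _)).
  exists (@ModHom k C (P 1%N) N _ fl fa), w; split=> //.
  apply: modhom_eq => x p /=.
  have -> : d0 x (pres_d P 1 x p) = 0 by apply/pres_exact; exists p.
  exact: (linear_zero (bfun_lin w _)).
Qed.

End ResolutionShift.

Theorem Ext_bar (k : fieldType) (C : lincat k) (M : rmod C)
    (P : proj_resolution M) (N : rmod C) n :
  sq_iso (coh_sq (hom_complex P N) n.+1) (coh_sq (bar_complex M N) n.+1).
Proof.
elim: n M P => [|n IH] M P; first exact: Ext1_bar.
apply: sq_iso_trans (hom_shift P N n) _.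
apply: sq_iso_trans (IH _ (shift_resolution P)) _.
exact: bar_shift (@pres_aug_surj k C M P) (@pres_projective k C M P 0) _.
Qed.

(** * Strings in a one-point extension *)

Section OnePointChains.
Variables (k : fieldType) (C : lincat k) (M : rmod C).
Let D := one_point M.
Let old (x : C) : D := Some x.
Let new : D := None.

Fixpoint emb n x z : chain n x z -> chain n (old x) (old z) :=
  match n return chain n x z -> chain n (old x) (old z) with
  | 0 => fun e => congr1 old e
  | m.+1 => fun c =>
      cons_chain ((projT2 c).1 : hom D (old (projT1 c)) (old z)) (emb (projT2 c).2)
  end.

Lemma emb_cons n x y z (f : hom C y z) (c : chain n x y) :
  emb (cons_chain f c) = cons_chain (f : hom D (old y) (old z)) (emb c).
Proof. by []. Qed.

Definition old_inj x z (e : old x = old z) : x = z := congr1 (odflt x) e.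

(** Extension by zero of a map on strings of C to the strings between objects
    of C that may pass through [new]. *)
Fixpoint ext (V : lmodType k) n x z :
    (chain n x z -> V) -> chain n (old x) (old z) -> V :=
  match n return (chain n x z -> V) -> chain n (old x) (old z) -> V with
  | 0 => fun phi e => phi (old_inj e)
  | m.+1 => fun phi c =>
      match projT1 c as y
        return hom D y (old z) * chain m (old x) y -> V with
      | Some y => fun fc => ext (fun c' => phi (cons_chain (y := y) fc.1 c')) fc.2
      | None => fun _ => 0
      end (projT2 c)
  end.

Lemma ext_lin (V : lmodType k) n x z a (phi psi : chain n x z -> V) c :
  ext (fun c => a *: phi c + psi c) c = a *: ext phi c + ext psi c.
Proof.
elim: n z phi psi c => [//|n IH] z phi psi [[y|] [f c]] /=; first exact: IH.
by rewrite scaler0 addr0.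
Qed.

Lemma ext_ml (V : lmodType k) n x z (phi : chain n x z -> V) :
  multilinear phi -> multilinear (ext phi).
Proof.
elim: n z phi => [//|n IH] z phi hphi [y|]; last first.
  by split=> [c a f g|f]; [rewrite /= scaler0 addr0 | apply: ml_zero].
split=> [c a f g|f]; last exact: (IH y _ ((hphi y).2 f)).
rewrite /= -ext_lin; congr (ext _ c); apply/funext => d.
by rewrite (hphi y).1.
Qed.

Lemma ext_emb (V : lmodType k) n x z (phi : chain n x z -> V) c :
  ext phi (emb c) = phi c.
Proof.
elim: n z phi c => [|n IH] z phi c /=; last by case: c => y [f c]; apply: IH.
by case: z / c phi.
Qed.

(** The entry that leaves [new] for an object of C is a zero morphism, so a
    multilinear map vanishes on any string through [new]. *)
Lemma ext_restr (V : lmodType k) n x z (phi : chain n (old x) (old z) -> V) c :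
  multilinear phi -> ext (fun c => phi (emb c)) c = phi c.
Proof.
elim: n z phi c => [|n IH] z phi c hphi /=.
  congr phi; exact: (Prop_irrelevance (congr1 old (old_inj c)) c).
case: c => [[y|] [f c]] /=; first exact: (IH y _ c ((hphi (old y)).2 f)).
by rewrite [f]thinmx0 (linear_zero ((hphi new).1 c)).
Qed.

Lemma ml_from_new (V : lmodType k) n z (phi : chain n new (old z) -> V) c :
  multilinear phi -> phi c = 0.
Proof.
elim: n z phi c => [//|n IH] z phi [[y|] [f c]] hphi.
  exact: (IH y _ c ((hphi (old y)).2 f)).
by rewrite [f]thinmx0; apply: (linear_zero ((hphi new).1 c)).
Qed.

Lemma bar_emb n z t (psi : forall w : D, chain n w (old z) -> hom D w (old t))
    x (c : chain n.+1 x z) :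
  bar psi (emb c) = bar (fun w c => psi (old w) (emb c) : hom C w t) c.
Proof.
elim: n z psi c => [|n IH] z psi [y [f c]].
  case: y / c f => f; rewrite -/(cons_chain f (erefl x : chain 0 x x)).
  by rewrite emb_cons !bar_nil.
case: c => w [g c]; rewrite -/(cons_chain g c) -/(cons_chain f (cons_chain g c)).
have := IH y (fun w c => psi w (cons_chain (f : hom D (old y) (old z)) c))
  (cons_chain g c).
by rewrite !emb_cons !bar_cons => ->.
Qed.

Lemma bar_emb_new n z (psi : forall w : D, chain n w (old z) -> hom D w new)
    x (c : chain n.+1 x z) :
  bar psi (emb c) = mbar (fun w c => psi (old w) (emb c) : M w) c.
Proof.
elim: n z psi c => [|n IH] z psi [y [f c]].
  case: y / c f => f; rewrite -/(cons_chain f (erefl x : chain 0 x x)).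
  by rewrite emb_cons bar_nil mbar_nil.
case: c => w [g c]; rewrite -/(cons_chain g c) -/(cons_chain f (cons_chain g c)).
have := IH y (fun w c => psi w (cons_chain (f : hom D (old y) (old z)) c))
  (cons_chain g c).
by rewrite !emb_cons bar_cons mbar_cons => ->.
Qed.

Lemma mbar_act n z t (m : M t) (psi : forall w : C, chain n w z -> hom C w t)
    x (c : chain n.+1 x z) :
  mbar (fun w c => act m (psi w c)) c = act m (bar psi c).
Proof.
elim: n z psi c => [|n IH] z psi [y [f c]].
  case: y / c f => f; rewrite -/(cons_chain f (erefl x : chain 0 x x)).
  by rewrite bar_nil mbar_nil actA.
case: c => w [g c]; rewrite -/(cons_chain g c) -/(cons_chain f (cons_chain g c)).
by rewrite mbar_cons bar_cons IH (linear_sub _ _ (act_linr m)).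
Qed.

End OnePointChains.

(** * Hochschild cochains of a one-point extension *)

Section OnePointCochains.
Variables (k : fieldType) (C : lincat k) (M : rmod C).
Let D := one_point M.
Let old (x : C) : D := Some x.
Let new : D := None.

Lemma emb_ml (V : lmodType k) n x z (phi : chain n (old x) (old z) -> V) :
  multilinear phi -> multilinear (fun c => phi (emb M c)).
Proof.
elim: n z phi => [//|n IH] z phi hphi y; split=> [c a f g|f].
  by rewrite /= ((hphi (old y)).1 (emb M c)).
exact: (IH y _ ((hphi (old y)).2 f)).
Qed.

Definition restrict n (phi : cochain D n) : cochain C n :=
  Cochain (fun x z => emb_ml (cochain_ml phi (old x) (old z))).

Fact restrict_linear n : linear (@restrict n).
Proof. by move=> a phi psi; apply: cochain_eq. Qed.

(** The part of a cochain of D that sees the strings m :: c with m in M and c a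
    string of C. *)
Definition at_new n (phi : cochain D n.+1) : bcochain M M n :=
  BCochain
    (phi := fun x y m c =>
       phi (old x) new (cons_chain (m : hom D (old y) new) (emb M c)))
    (fun x y c => (cochain_ml phi (old x) new (old y)).1 (emb M c))
    (fun x y m => emb_ml ((cochain_ml phi (old x) new (old y)).2 m)).

(** The chain map whose mapping cone is, up to a shift and a homotopy, the
    Hochschild complex of D in positive degrees. *)
Definition bar_act n (phi : cochain C n) : bcochain M M n :=
  BCochain
    (phi := fun x y m c => act m (phi x y c))
    (fun x y c => act_linl (phi x y c))
    (fun x y m => ml_comp (act_linr m) (cochain_ml phi x y)).

Fact bar_act_linear n : linear (@bar_act n).
Proof.
by move=> a phi psi; apply: bcochain_eq => x y m c; apply: (act_linr m).
Qed.

Lemma bar_act_d n (phi : cochain C n) :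
  bar_act (hoch_d phi) = bar_d (bar_act phi).
Proof.
apply: bcochain_eq => x z m [y [f c]]; rewrite -/(cons_chain f c) bar_dE.
rewrite mbar_act /bfun [LHS]/= -[hoch_d_fun _ _]/(hoch_d phi x z (cons_chain f c)).
by rewrite hoch_dE (linear_sub _ _ (act_linr m)) -actA.
Qed.

Lemma restrict_d n (phi : cochain D n) :
  restrict (hoch_d phi) = hoch_d (restrict phi).
Proof.
apply: cochain_eq => x z [y [f c]]; rewrite -/(cons_chain f c) hoch_dE.
rewrite [LHS](_ : _ = hoch_d phi (old x) (old z)
  (cons_chain (f : hom D (old y) (old z)) (emb M c))) // hoch_dE -emb_cons bar_emb.
by [].
Qed.

(** The leading face multiplies by m the values on strings of C; the other
    faces of m :: c form the bar differential, up to sign. *)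
Lemma at_new_d n (phi : cochain D n.+1) :
  at_new (hoch_d phi) = bar_act (restrict phi) - bar_d (at_new phi).
Proof.
apply: bcochain_eq => x z m [y [f c]]; rewrite -/(cons_chain f c).
rewrite bfun_sub bar_dE.
rewrite [LHS](_ : _ = hoch_d phi (old x) new (cons_chain (m : hom D (old z) new)
  (cons_chain (f : hom D (old y) (old z)) (emb M c)))) // hoch_dE bar_cons.
by rewrite -emb_cons bar_emb_new.
Qed.

Definition bar_id : bcochain M M 0 := bcochain0 (fun y => @mfun_lin _ _ _ _ (modid M) y).

Lemma at_new_d0 (phi : cochain D 0) :
  at_new (hoch_d phi) = bar_act (restrict phi) - (phi new new erefl : k) *: bar_id.
Proof.
apply: bcochain0_eq => y m; rewrite bfun_sub.
rewrite [LHS](_ : _ = hoch_d phi (old y) new (cons_chain (m : hom D (old y) new)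
  (erefl : chain 0 (old y) (old y)))) // hoch_dE bar_nil.
by [].
Qed.

Definition glue_fun n (phi : cochain C n.+1) (psi : bcochain M M n) x z :
    chain n.+1 x z -> hom D x z :=
  match x, z return chain n.+1 (x : D) (z : D) -> hom D x z with
  | Some x, Some z => ext (phi x z)
  | Some x, None => fun c =>
      match projT1 c as y return hom D y new * chain n (old x) y -> M x with
      | Some y => fun mc => ext (bfun psi (x := x) (y := y) mc.1) mc.2
      | None => fun _ => 0
      end (projT2 c)
  | None, _ => fun _ => 0
  end.

Fact glue_ml n (phi : cochain C n.+1) (psi : bcochain M M n) x z :
  multilinear (@glue_fun n phi psi x z).
Proof.
case: x z => [x|] [z|]; try exact: ml_zero.
  exact: (@ext_ml k C M (hom C x z) n.+1 x z _ (cochain_ml phi x z)).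
move=> [y|]; last first.
  by split=> [c a f g|f]; [rewrite /= scaler0 addr0 | apply: ml_zero].
split=> [c a m m'|m].
  change (ext (bfun psi (x := x) (y := y) (a *: (m : M y) + m')) c =
    a *: ext (bfun psi (x := x) (m : M y)) c + ext (bfun psi (x := x) (m' : M y)) c).
  by rewrite -ext_lin; congr (ext _ c); apply/funext => d; rewrite bfun_lin.
change (multilinear (ext (M := M) (bfun psi (x := x) (m : M y)))).
exact: (ext_ml M (bfun_ml psi x (m : M y))).
Qed.

Definition glue n (phi : cochain C n.+1) (psi : bcochain M M n) :
  cochain D n.+1 := Cochain (@glue_ml n phi psi).

Lemma glue_linear n a (phi phi' : cochain C n.+1) (psi psi' : bcochain M M n) :
  glue (a *: phi + phi') (a *: psi + psi') = a *: glue phi psi + glue phi' psi'.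
Proof.
apply: cochain_eq => [[x|] [z|]] c.
- exact: (ext_lin (M := M) a (phi x z) (phi' x z) c).
- case: c => [[y|] [m c]]; last by rewrite /= scaler0 addr0.
  exact: (ext_lin (M := M) a (bfun psi (x := x) (m : M y)) (bfun psi' (x := x) m) c).
- by rewrite /= scaler0 addr0.
- by rewrite /= scaler0 addr0.
Qed.

Lemma restrict_glue n (phi : cochain C n.+1) (psi : bcochain M M n) :
  restrict (glue phi psi) = phi.
Proof. by apply: cochain_eq => x z c; apply: ext_emb. Qed.

Lemma at_new_glue n (phi : cochain C n.+1) (psi : bcochain M M n) :
  at_new (glue phi psi) = psi.
Proof. by apply: bcochain_eq => x y m c; apply: ext_emb. Qed.

(** Prepending the identity of [new] is possible only for strings that end
    there; the homotopy is zero on the others. *)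
Definition prepend1_fun n (phi : cochain D n.+1) x z : chain n x z -> hom D x z :=
  match z return chain n x (z : D) -> hom D x z with
  | Some z => fun _ => 0
  | None => fun c => phi x new (cons_chain ((1 : k^o) : hom D new new) c)
  end.

Fact prepend1_ml n (phi : cochain D n.+1) x z : multilinear (@prepend1_fun n phi x z).
Proof.
case: z => [z|]; first exact: ml_zero.
exact: (cochain_ml phi x new new).2.
Qed.

Definition prepend1 n (phi : cochain D n.+1) : cochain D n := Cochain (@prepend1_ml n phi).

Lemma prepend1_0 n : prepend1 (0 : cochain D n.+1) = 0.
Proof. by apply: cochain_eq => x [z|]. Qed.

Lemma bar0 (E : lincat k) n z t x (c : chain n.+1 x z) :
  bar (fun w _ => 0 : hom E w t) c = 0.
Proof.
rewrite (bar_eq (psi' := fun w _ => 0 - 0)) ?bar_sub ?subrr // => w _.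
by rewrite subrr.
Qed.

Lemma prepend1_glue n (phi : cochain C n.+1) (psi : bcochain M M n) :
  prepend1 (glue phi psi) = 0.
Proof. by apply: cochain_eq => [[x|] [z|]] c. Qed.

(** Let f :: c be a string ending at [new].  The leading face of 1 :: f :: c
    cancels against the face that composes 1 and f, and its other faces against
    those of f :: c, which leaves f phi(1 :: c).
    If f is a scalar this is phi(f :: c) by linearity, and if f is an element of
    M it is 0, as the homotopy vanishes on the string c, which ends in C. *)
Lemma glue_homotopy n (phi : cochain D n.+1) :
  hoch_d (prepend1 phi) + prepend1 (hoch_d phi) = phi - glue (restrict phi) (at_new phi).
Proof.
apply/eqP; rewrite eq_sym subr_eq; apply/eqP/esym.
apply: cochain_eq => x [z|] [y [f c]]; rewrite -/(cons_chain f c).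
- rewrite [LHS](_ : _ = hoch_d (prepend1 phi) x (old z) (cons_chain f c) + 0
    + glue (restrict phi) (at_new phi) x (old z) (cons_chain f c)) //.
  rewrite hoch_dE addr0 [X in _ - X]bar0 subr0.
  have -> : comp f (prepend1 phi x y c) = 0 :> hom D x (old z).
    case: y f c => [y|] f c; first exact: (linear_zero (comp_linr f)).
    by rewrite [f]thinmx0 (linear_zero (comp_linl _)).
  rewrite add0r; case: x c => [x|] c; last by rewrite [LHS]thinmx0 [RHS]thinmx0.
  exact: (ext_restr (cons_chain f c) (cochain_ml phi (old x) (old z))).
- rewrite [LHS](_ : _ = hoch_d (prepend1 phi) x new (cons_chain f c)
    + hoch_d phi x new (cons_chain ((1 : k^o) : hom D new new) (cons_chain f c))
    + glue (restrict phi) (at_new phi) x new (cons_chain f c)) //.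
  rewrite !hoch_dE bar_cons.
  have -> : comp ((1 : k^o) : hom D new new) f = f := comp1m (l := D) f.
  have -> : comp ((1 : k^o) : hom D new new) (phi x new (cons_chain f c)) =
    phi x new (cons_chain f c) := comp1m (l := D) _.
  have -> : bar (fun w => prepend1 phi w new) (cons_chain f c) =
    bar (fun w d => phi w new (cons_chain ((1 : k^o) : hom D new new) d))
      (cons_chain f c) by [].
  rewrite subKr subrK; case: y f c => [y|] f c.
    rewrite (linear_zero (comp_linr f)) add0r.
    have fml := (cochain_ml phi x new (old y)).2 f.
    case: x c fml => [x|] c fml; first exact: (ext_restr c fml).
    exact/esym/(ml_from_new c fml).
  have -> : glue (restrict phi) (at_new phi) x new (cons_chain (f : hom D new new) c) = 0.
    by case: (x) c.
  have e1 : f = (f : k) *: (1 : k^o) by rewrite [RHS]mulr1.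
  rewrite addr0 {2}e1 (linear_scale ((cochain_ml phi x new new).1 c)).
  by case: (x) c.
Qed.

Lemma prepend1_d0 (phi : cochain D 0) : prepend1 (hoch_d phi) = 0.
Proof.
apply: cochain_eq => x [z|] c //.
rewrite [LHS](_ : _ = hoch_d phi x new (cons_chain ((1 : k^o) : hom D new new) c)) //.
have e : x = new := c; subst x.
have -> : c = (erefl : new = new) := Prop_irrelevance (c : new = new) erefl.
rewrite hoch_dE bar_nil [X in X - _](comp1m (l := D)) [X in _ - X](compm1 (l := D)).
exact: subrr.
Qed.

(** A pair is killed by [prepend1], and by [glue_homotopy] so is its coboundary;
    a second use of the homotopy shows that the coboundary is again a pair,
    whose components are given by [restrict_d] and [at_new_d]. *)
Lemma d_glue n (phi : cochain C n.+1) (psi : bcochain M M n) :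
  hoch_d (glue phi psi) = glue (hoch_d phi) (bar_act phi - bar_d psi).
Proof.
pose G := glue phi psi.
have sdG : prepend1 (hoch_d G) = 0.
  have := glue_homotopy G; rewrite prepend1_glue restrict_glue at_new_glue subrr.
  by rewrite (linear_zero (@hoch_d_linear k D n)) add0r.
have := glue_homotopy (hoch_d G).
rewrite sdG (linear_zero (@hoch_d_linear k D n.+1)) hoch_dd add0r.
rewrite restrict_d at_new_d restrict_glue at_new_glue prepend1_0.
by move/esym/eqP; rewrite subr_eq0 => /eqP.
Qed.

Definition glue0_fun (phi : cochain C 0) (a : k) x z (e : chain 0 x z) : hom D x z :=
  match e in _ = z return hom D x z with
  | erefl => match x return hom D x x with
             | Some x => phi x x erefl
             | None => (a : k^o)
             end
  end.

Definition glue0 (phi : cochain C 0) (a : k) : cochain D 0 :=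
  @Cochain k D 0 (@glue0_fun phi a) (fun _ _ => I).

Lemma restrict_glue0 phi a : restrict (glue0 phi a) = phi.
Proof. by apply: cochain_eq => x z c; case: z / c. Qed.

Lemma d_glue0 (phi : cochain C 0) a :
  hoch_d (glue0 phi a) = glue (hoch_d phi) (bar_act phi - a *: bar_id).
Proof.
have := glue_homotopy (hoch_d (glue0 phi a)).
rewrite prepend1_d0 (linear_zero (@hoch_d_linear k D 0)) hoch_dd add0r prepend1_0.
move/esym/eqP; rewrite subr_eq0 => /eqP ->.
by rewrite restrict_d at_new_d0 restrict_glue0.
Qed.

End OnePointCochains.

(** * The long exact sequence of the cone *)

Section LongExactSequence.
Variables (k : fieldType) (C : lincat k) (M : rmod C).
Let D := one_point M.

Lemma hoch_d0 (E : lincat k) n : hoch_d (0 : cochain E n) = 0.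
Proof. exact: linear_zero (@hoch_d_linear k E n). Qed.

Lemma hoch_d_add (E : lincat k) n (phi psi : cochain E n) :
  hoch_d (phi + psi) = hoch_d phi + hoch_d psi.
Proof. exact: (linear_add (@hoch_d_linear k E n) phi psi). Qed.

Lemma bar_d_0 (L N : rmod C) n : bar_d (0 : bcochain L N n) = 0.
Proof. exact: linear_zero (@bar_d_linear k C L N n). Qed.

Lemma bar_d_opp (L N : rmod C) n (psi : bcochain L N n) :
  bar_d (- psi) = - bar_d psi.
Proof. by rewrite -[- psi]sub0r bar_d_sub bar_d_0 sub0r. Qed.

Lemma restrict0 n : restrict (0 : cochain D n) = 0.
Proof. exact: linear_zero (@restrict_linear k C M n). Qed.

Lemma restrict_sub n (phi psi : cochain D n) : 
  restrict (phi - psi) = restrict phi - restrict psi.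
Proof. exact: linear_sub (@restrict_linear k C M n). Qed.

Lemma bar_act0 n : bar_act M (0 : cochain C n) = 0.
Proof. exact: linear_zero (@bar_act_linear k C M n). Qed.

Lemma glue_00 n : glue (0 : cochain C n.+1) (0 : bcochain M M n) = 0.
Proof.
by rewrite -[0 in LHS](subrr 0) -[X in glue _ X](addNr 0)
   -scaleN1r addrC -scaleN1r glue_linear scaleN1r addNr.
Qed.

Lemma glue_sub n (phi phi' : cochain C n.+1) (psi psi' : bcochain M M n) :
  glue (phi - phi') (psi - psi') = glue phi psi - glue phi' psi'.
Proof.
by rewrite [in LHS]addrC [psi - _]addrC -!scaleN1r glue_linear scaleN1r addrC.
Qed.

Lemma normalize n (phi : cochain D n.+1) : hoch_d phi = 0 ->
  exists chi, hoch_d chi = phi - glue (restrict phi) (at_new phi).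
Proof.
by move=> dphi; exists (prepend1 phi); rewrite -glue_homotopy dphi prepend1_0 addr0.
Qed.

(** End(M) modulo scalars, presented by bar cochains of degree 0. *)
Definition end_sq : subquot k :=
  SubQuot (fun w : bcochain M M 0 => bar_d w = 0) (fun w => exists a, w = a *: bar_id M).

Lemma end_mod_scalars_sq : sq_iso (space_sq (end_mod_scalars M)) end_sq.
Proof.
apply: sq_iso_trans (lquot_sq _) _.
exists (fun (g : modhom M M) w => forall x m, g x m = bfun w m (erefl : chain 0 x x)).
split=> /=.
- by move=> a g w g' w' gw gw' x m; rewrite bfun_linear -gw -gw'.
- move=> g w gw; split=> //.
    by apply/bar_d0_eq0 => x y m f; rewrite -!gw mfun_act.
  split=> [/asboolP[a ga]|[a wa]].
    by exists a; apply: bcochain0_eq => x m; rewrite -gw ga.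
  by apply/asboolP; exists a; apply: modhom_eq => x m; rewrite gw wa.
- move=> g _; exists (bcochain0 (@mfun_lin _ _ _ _ g)) => x m.
  by [].
- by move=> w /bar_d0_modhom.
Qed.

Lemma restrict_cyc n (phi : cochain D n) :
  hoch_d phi = 0 -> hoch_d (restrict phi) = 0.
Proof. by rewrite -restrict_d => ->; rewrite restrict0. Qed.

Lemma bar_act_cyc n (phi : cochain C n) :
  hoch_d phi = 0 -> bar_d (bar_act M phi) = 0.
Proof. by rewrite -bar_act_d => ->; rewrite bar_act0. Qed.

Lemma d_glue_l n (psi : bcochain M M n) :
  hoch_d (glue (0 : cochain C n.+1) psi) = glue 0 (- bar_d psi).
Proof. by rewrite d_glue hoch_d0 bar_act0 sub0r. Qed.

Lemma glue_cyc n (psi : bcochain M M n) :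
  bar_d psi = 0 -> hoch_d (glue (0 : cochain C n.+1) psi) = 0.
Proof. by rewrite d_glue_l => ->; rewrite oppr0 glue_00. Qed.

Lemma restrict_bnd n (phi : cochain D n) : hoch_d phi = 0 ->
  is_coboundary (X := hoch_complex D) phi ->
  is_coboundary (X := hoch_complex C) (restrict phi).
Proof.
case: n phi => [|n] phi _ /=; first by move=> ->; rewrite restrict0.
by case=> chi <-; exists (restrict chi); rewrite restrict_d.
Qed.

Lemma bar_act_bnd0 (phi : cochain C 0) : hoch_d phi = 0 ->
  phi = 0 -> exists a, bar_act M phi = a *: bar_id M.
Proof. by move=> _ ->; exists 0; rewrite bar_act0 scale0r. Qed.

Lemma bar_act_bnd n (phi : cochain C n.+1) : hoch_d phi = 0 ->
  (exists chi, hoch_d chi = phi) -> exists psi, bar_d psi = bar_act M phi.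
Proof. by move=> _ [chi <-]; exists (bar_act M chi); rewrite bar_act_d. Qed.

Lemma glue_l_linear n :
  linear (fun psi : bcochain M M n => glue (0 : cochain C n.+1) psi).
Proof. by move=> a psi psi'; rewrite -glue_linear scaler0 addr0. Qed.

Lemma glue_bnd0 (psi : bcochain M M 0) : bar_d psi = 0 ->
  (exists a, psi = a *: bar_id M) ->
  exists chi : cochain D 0, hoch_d chi = glue (0 : cochain C 1) psi.
Proof.
move=> _ [a ->]; exists (glue0 M 0 (- a)).
by rewrite d_glue0 hoch_d0 bar_act0 sub0r scaleNr opprK.
Qed.

Lemma glue_bnd n (psi : bcochain M M n.+1) : bar_d psi = 0 ->
  (exists chi, bar_d chi = psi) ->
  exists chi : cochain D n.+1, hoch_d chi = glue (0 : cochain C n.+2) psi.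
Proof.
move=> _ [chi <-]; exists (glue 0 (- chi)).
by rewrite d_glue_l bar_d_opp opprK.
Qed.

(** The next six lemmas are exactness on representatives, first in the low
    degrees, where the scalar at [new] enters, and then in general.  Witnesses
    are pairs, and conversely the components of a cochain of D. *)
Lemma exact_HH0 (v : cochain C 0) : hoch_d v = 0 ->
  (exists a, bar_act M v = a *: bar_id M) <->
  (exists2 u : cochain D 0, hoch_d u = 0 & v - restrict u = 0).
Proof.
move=> dv; split=> [[a va]|[u du /eqP]].
  exists (glue0 M v a); last by rewrite restrict_glue0 subrr.
  by rewrite d_glue0 dv va subrr glue_00.
rewrite subr_eq0 => /eqP ->; exists (u None None erefl : k).
by apply/eqP; rewrite -subr_eq0 -at_new_d0 du; apply/eqP/bcochain_eq.
Qed.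

Lemma exact_End (psi : bcochain M M 0) :
  (exists x : cochain D 0, hoch_d x = glue 0 psi) <->
  (exists2 u : cochain C 0, hoch_d u = 0 & exists a, psi - bar_act M u = a *: bar_id M).
Proof.
split=> [[x dx]|[u du [a ua]]].
  exists (restrict x); first by rewrite -restrict_d dx restrict_glue.
  exists (- (x None None erefl : k)).
  have := at_new_d0 x; rewrite dx at_new_glue => ->.
  by rewrite addrC addKr scaleNr.
exists (glue0 M u (- a)); rewrite d_glue0 du scaleNr opprK -ua addrC subrK.
by [].
Qed.

Lemma exact_HH1_one_point (v : cochain D 1) : hoch_d v = 0 ->
  (exists x : cochain C 0, hoch_d x = restrict v) <->
  (exists2 psi : bcochain M M 0, bar_d psi = 0 &
     exists y, hoch_d y = v - glue (0 : cochain C 1) psi).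
Proof.
move=> dv; split=> [[x dx]|[psi _ [y dy]]]; last first.
  by exists (restrict y); rewrite -restrict_d dy restrict_sub restrict_glue subr0.
exists (at_new v - bar_act M x).
  rewrite bar_d_sub -bar_act_d dx; apply/eqP.
  by rewrite -oppr_eq0 opprB -at_new_d dv; apply/eqP/bcochain_eq.
have [y dy] := normalize dv.
exists (y + glue0 M x 0); rewrite hoch_d_add dy d_glue0 dx scale0r subr0.
by rewrite -addrA; congr (v + _); rewrite -[LHS]opprK opprD opprK -glue_sub subrr.
Qed.

Lemma exact_HH n (v : cochain C n.+1) : hoch_d v = 0 ->
  (exists w, bar_d w = bar_act M v) <->
  (exists2 u : cochain D n.+1, hoch_d u = 0 &
     exists x : cochain C n, hoch_d x = v - restrict u).
Proof.
move=> dv; split=> [[w dw]|[u du [x dx]]].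
  exists (glue v w); first by rewrite d_glue dv dw subrr glue_00.
  by exists 0; rewrite hoch_d0 restrict_glue subrr.
exists (bar_act M x - - at_new u); rewrite bar_d_sub bar_d_opp opprK -bar_act_d dx.
have : bar_act M (restrict u) = bar_d (at_new u).
  by apply/eqP; rewrite -subr_eq0 -at_new_d du; apply/eqP/bcochain_eq.
by rewrite (linear_sub _ _ (@bar_act_linear k C M n.+1)) => ->; rewrite subrK.
Qed.

Lemma exact_Ext n (psi : bcochain M M n.+1) :
  (exists x : cochain D n.+1, hoch_d x = glue 0 psi) <->
  (exists2 u : cochain C n.+1, hoch_d u = 0 & exists w, bar_d w = psi - bar_act M u).
Proof.
split=> [[x dx]|[u du [w dw]]].
  exists (restrict x); first by rewrite -restrict_d dx restrict_glue.
  exists (- at_new x); have := at_new_d x; rewrite dx at_new_glue => ->.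
  by rewrite addrC addKr bar_d_opp.
exists (glue u (- w)); rewrite d_glue du bar_d_opp opprK dw addrC subrK.
by [].
Qed.

Lemma exact_HH_one_point n (v : cochain D n.+2) : hoch_d v = 0 ->
  (exists x : cochain C n.+1, hoch_d x = restrict v) <->
  (exists2 psi : bcochain M M n.+1, bar_d psi = 0 &
     exists y, hoch_d y = v - glue (0 : cochain C n.+2) psi).
Proof.
move=> dv; split=> [[x dx]|[psi _ [y dy]]]; last first.
  by exists (restrict y); rewrite -restrict_d dy restrict_sub restrict_glue subr0.
exists (at_new v - bar_act M x).
  rewrite bar_d_sub -bar_act_d dx; apply/eqP.
  by rewrite -oppr_eq0 opprB -at_new_d dv; apply/eqP/bcochain_eq.
have [y dy] := normalize dv.
exists (y + glue x 0); rewrite hoch_d_add dy d_glue dx bar_d_0 subr0.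
by rewrite -addrA; congr (v + _); rewrite -[LHS]opprK opprD opprK -glue_sub subrr.
Qed.

(** A central element of D whose C-component vanishes is a scalar a at [new]
    with a m = 0 for all m in M. *)
Lemma restrict_inj0 x (m : M x) (u : cochain D 0) :
  m <> 0 -> hoch_d u = 0 -> restrict u = 0 -> u = 0.
Proof.
move=> m0 du ru; have um : (u None None erefl : k) *: m = 0.
  have := congr1 (fun w : bcochain M M 0 => bfun w m erefl) (at_new_d0 u).
  rewrite du ru bar_act0 sub0r -scaleNr => /esym/eqP.
  by rewrite [bfun _ _ _]scaleNr oppr_eq0 => /eqP.
apply: cochain_eq => [[y|] z e]; case: z / e.
  exact: (congr1 (fun w : cochain C 0 => w y y erefl) ru).
move/eqP: um; rewrite scaler_eq0 => /orP[/eqP //|/eqP //].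
Qed.

End LongExactSequence.

Theorem theorem4p2 (k : fieldType) (C : lincat k) (M : rmod C)
    (P : proj_resolution M) :
  exists (iota : forall n : nat, {linear HH (one_point M) n -> HH C n})
         (theta0 : {linear HH C 0 -> end_mod_scalars M})
         (theta : forall n : nat, {linear HH C n.+1 -> Ext P M n.+1})
         (delta0 : {linear end_mod_scalars M -> HH (one_point M) 1})
         (delta : forall n : nat,
            {linear Ext P M n.+1 -> HH (one_point M) n.+2}),
    ((exists (x : C) (m : M x), m <> 0%R) -> injective (iota 0)) /\
    exact_at (iota 0) theta0 /\
    exact_at theta0 delta0 /\
    exact_at delta0 (iota 1) /\
    (forall n : nat,
       exact_at (iota n.+1) (theta n) /\
       exact_at (theta n) (delta n) /\
       exact_at (delta n) (iota n.+2)).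
Proof.
pose D := one_point M.
pose rD n := projT2 (cid (cohomology_sq (hoch_complex D) n)).
pose rC n := projT2 (cid (cohomology_sq (hoch_complex C) n)).
pose rE n := projT2 (cid
  (sq_iso_trans (cohomology_sq (hom_complex P M) n.+1) (Ext_bar P M n))).
pose r0 := projT2 (cid (end_mod_scalars_sq M)).
have iotaP n := cid (sq_map (rD n) (rC n) (@restrict_linear k C M n)
  (@restrict_cyc k C M n) (@restrict_bnd k C M n)).
have theta0P := cid (sq_map (rC 0) r0 (@bar_act_linear k C M 0)
  (@bar_act_cyc k C M 0) (@bar_act_bnd0 k C M)).
have thetaP n := cid (sq_map (rC n.+1) (rE n) (@bar_act_linear k C M n.+1)
  (@bar_act_cyc k C M n.+1) (@bar_act_bnd k C M n)).
have delta0P := cid (sq_map r0 (rD 1) (@glue_l_linear k C M 0)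
  (@glue_cyc k C M 0) (@glue_bnd0 k C M)).
have deltaP n := cid (sq_map (rE n) (rD n.+2) (@glue_l_linear k C M n.+1)
  (@glue_cyc k C M n.+1) (@glue_bnd k C M n)).
exists (fun n => projT1 (iotaP n)), (projT1 theta0P), (fun n => projT1 (thetaP n)).
exists (projT1 delta0P), (fun n => projT1 (deltaP n)).
split; last split; last split; last split; last move=> n; last split; last split.
- move=> [x [m m0]].
  apply: (sq_inj (rD 0) (rC 0) (@restrict_cyc k C M 0) (projT2 (iotaP 0))) => u du /= ru.
  exact: restrict_inj0 m0 du ru.
- exact: (sq_exact (rD 0) (rC 0) r0 (@restrict_cyc k C M 0) (@bar_act_cyc k C M 0)
    (projT2 (iotaP 0)) (projT2 theta0P) (@exact_HH0 k C M)).
- exact: (sq_exact (rC 0) r0 (rD 1) (@bar_act_cyc k C M 0) (@glue_cyc k C M 0)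
    (projT2 theta0P) (projT2 delta0P) (fun psi _ => @exact_End k C M psi)).
- exact: (sq_exact r0 (rD 1) (rC 1) (@glue_cyc k C M 0) (@restrict_cyc k C M 1)
    (projT2 delta0P) (projT2 (iotaP 1)) (@exact_HH1_one_point k C M)).
- exact: (sq_exact (rD n.+1) (rC n.+1) (rE n) (@restrict_cyc k C M n.+1)
    (@bar_act_cyc k C M n.+1) (projT2 (iotaP n.+1)) (projT2 (thetaP n))
    (@exact_HH k C M n)).
- exact: (sq_exact (rC n.+1) (rE n) (rD n.+2) (@bar_act_cyc k C M n.+1)
    (@glue_cyc k C M n.+1) (projT2 (thetaP n)) (projT2 (deltaP n))
    (fun psi _ => @exact_Ext k C M n psi)).
- exact: (sq_exact (rE n) (rD n.+2) (rC n.+2) (@glue_cyc k C M n.+1)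
    (@restrict_cyc k C M n.+2) (projT2 (deltaP n)) (projT2 (iotaP n.+2))
    (@exact_HH_one_point k C M n)).
Qed.
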